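(* Let $\mathbb K$ be a field of characteristic zero and $\mathfrak b\subset\mathfrak{sl}_2(\mathbb K)$ the two-dimensional Borel subalgebra, with basis $e_1,e_2$ and $[e_1,e_2]=2e_1$. Then the DGLA of Drinfeld $\bigotimes\mathcal U_{\mathfrak b}$ is formal: there exists an $L_\infty$ quasi-isomorphism from the graded Lie algebra $E(\mathfrak b)$ (its cohomology) to $\bigotimes\mathcal U_{\mathfrak b}$.
   Context: For a Lie algebra $\mathfrak g$, the DGLA of Drinfeld $\bigotimes\mathcal U_{\mathfrak g}=D$ has $D^{-1}=\mathbb K$, $D^k=\mathcal U_{\mathfrak g}^{\otimes(k+1)}$ ($k\ge0$), differential $\delta\Phi=\Phi\otimes1-\sum_{l=0}^k(-1)^{k-l}\Delta_l\Phi+(-1)^k1\otimes\Phi$ ($\Delta_l$ = standard coproduct $\Delta e=e\otimes1+1\otimes e$ applied to the $l$-th factor), and bracket $[\Phi_1,\Phi_2]_G=\Phi_1\circ\Phi_2-(-1)^{k_1k_2}\Phi_2\circ\Phi_1$, where $\Phi_1\circ\Phi_2=\sum_{i=0}^{k_1}(-1)^{ik_2}\Delta^{k_2}_i(\Phi_1)(1^{\otimes i}\otimes\Phi_2\otimes1\otimes\cdots\otimes1)$ and $\Delta^{k}_i$ applies the $k$-fold iterated coproduct $\Delta^k=(\Delta\otimes1^{\otimes(k-1)})\cdots(\Delta\otimes1)\Delta$ to the $i$-th factor. Its cohomology is the exterior algebra $E(\mathfrak g)$ ($\wedge^{k+1}\mathfrak g$ in degree $k$) with graded Lie bracket extending that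 of $\mathfrak g$ by the Leibniz rule $[\gamma,\gamma_1\wedge\gamma_2]=[\gamma,\gamma_1]\wedge\gamma_2+(-1)^{k(k_1+1)}\gamma_1\wedge[\gamma,\gamma_2]$. A DGLA is formal if there is an $L_\infty$ quasi-isomorphism from its cohomology graded Lie algebra to it (an $L_\infty$-morphism whose first component induces an isomorphism in cohomology). *)

(* Defs.v *)
From HB Require Import structures.
From mathcomp Require Import all_boot all_order all_algebra.
From mathcomp Require Import freeg.

Set Implicit Arguments.
Unset Strict Implicit.
Unset Printing Implicit Defensive.

Import Order.TTheory GRing.Theory Num.Theory.
Local Open Scope ring_scope.

Section DrinfeldBorel.
Variable K : fieldType.

Definition sgn (z : int) : K := if odd (absz z) then -1 else 1.

(* b has basis e1, e2 with [e1,e2] = 2 e1.  By PBW, U_b has basis the  *)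
(* ordered monomials e1^a e2^b, encoded by the pair (a,b).  A basis    *)
(* element of U_b^{(x) n} is a list of n such pairs:                   *)
(*   [:: (a_1,b_1); ...; (a_n,b_n)]  <->  e1^a_1 e2^b_1 (x) ... (x)    *)
(*                                        e1^a_n e2^b_n.               *)
(* D := (+)_{n >= 0} U_b^{(x) n} is the free K-module on such lists;   *)
(* the summand U_b^{(x) (k+1)} is the degree-k part D^k (k >= -1).     *)
Definition Mon := seq (nat * nat).
Definition DD := {freeg Mon / K}.
Definition bD (m : Mon) : DD := [freeg [:: ((1 : K), m)]].

Definition degM (m : Mon) : int := (size m)%:Z - 1.

Definition homogD (k : int) (x : DD) : Prop :=
  forall m, m \in dom x -> degM m = k.

Definition bilin (M : lmodType K) (f : Mon -> Mon -> M) (x y : DD) : M :=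
  fglift (fun m => fglift (fun m' => f m m') y) x.

Definition ones (n : nat) : Mon := nseq n (0%N, 0%N).

Definition tens (x y : DD) : DD := bilin (fun m m' => bD (m ++ m')) x y.

(* product in U_b of two PBW monomials:
   e1^a e2^b . e1^c e2^d = e1^(a+c) (e2 - 2c)^b e2^d
   (since e2 e1 = e1 (e2 - 2)), expanded in the PBW basis *)
Definition umul1 (p q : nat * nat) : DD :=
  \sum_(j < p.2.+1)
     (('C(p.2, j))%:R * (- (2 * q.1)%:R) ^+ (p.2 - j)) *:
       bD [:: (p.1 + q.1, j + q.2)%N].

Definition umul_mon (m m' : Mon) : DD :=
  if size m == size m' then
    foldr (fun pq acc => tens (umul1 pq.1 pq.2) acc) (bD [::]) (zip m m')
  else 0.
Definition umul (x y : DD) : DD := bilin umul_mon x y.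

(* Delta_l : the coproduct Delta e = e (x) 1 + 1 (x) e applied to the l-th
   factor (factors numbered from 0).  On PBW monomials:
   Delta (e1^a e2^b) = sum_{i,j} C(a,i) C(b,j) e1^i e2^j (x) e1^(a-i) e2^(b-j). *)
Definition delta_at_mon (l : nat) (m : Mon) : DD :=
  if (l < size m)%N then
    let p := nth (0%N, 0%N) m l in
    \sum_(i < p.1.+1) \sum_(j < p.2.+1)
       (('C(p.1, i) * 'C(p.2, j))%N%:R) *:
         bD (take l m ++ [:: (i : nat, j : nat); (p.1 - i, p.2 - j)%N]
                      ++ drop l.+1 m)
  else 0.
Definition delta_at (l : nat) (x : DD) : DD := fglift (delta_at_mon l) x.

Definition eps_at_mon (l : nat) (m : Mon) : DD :=
  if (l < size m)%N && (nth (0%N, 0%N) m l == (0%N, 0%N))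
  then bD (take l m ++ drop l.+1 m) else 0.
Definition eps_at (l : nat) (x : DD) : DD := fglift (eps_at_mon l) x.

(* Delta^k_i : the k-fold iterated coproduct
   Delta^k = (Delta (x) 1^{k-1}) ... (Delta (x) 1) Delta  applied to the
   i-th factor; Delta^0 = id, and Delta^{-1} = epsilon (counit). *)
Definition iter_cop (k : int) (i : nat) (x : DD) : DD :=
  match k with
  | Posz n => iter n (delta_at i) x
  | Negz 0 => eps_at i x
  | Negz _ => 0
  end.

Definition circ_mon (m1 m2 : Mon) : DD :=
  \sum_(i < size m1)
     sgn (i%:Z * degM m2) *:
       umul (iter_cop (degM m2) i (bD m1))
            (bD (ones i ++ m2 ++ ones (size m1 - i.+1))).

Definition gbr_mon (m1 m2 : Mon) : DD :=
  circ_mon m1 m2 - sgn (degM m1 * degM m2) *: circ_mon m2 m1.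
Definition gbr (x y : DD) : DD := bilin gbr_mon x y.

Definition dD_mon (m : Mon) : DD :=
  bD (m ++ [:: (0%N, 0%N)])
  - \sum_(l < size m) sgn (degM m - l%:Z) *: delta_at l (bD m)
  + sgn (degM m) *: bD ((0%N, 0%N) :: m).
Definition dD (x : DD) : DD := fglift dD_mon x.

(* The graded Lie algebra E(b) = wedge^* b, wedge^{k+1} b in degree k. *)
(* Basis (as 'I_4):  0 = 1 (in wedge^0 b = K, degree -1),              *)
(*                   1 = e1, 2 = e2 (degree 0),                        *)
(*                   3 = e1 /\ e2 (degree 1).                          *)
Definition EB := 'I_4.
Definition EE := {freeg EB / K}.
Definition bE (b : EB) : EE := [freeg [:: ((1 : K), b)]].

Definition Eone : EB := @Ordinal 4 0 isT.
Definition Ee1  : EB := @Ordinal 4 1 isT.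
Definition Ee2  : EB := @Ordinal 4 2 isT.
Definition Ew   : EB := @Ordinal 4 3 isT.

Definition degE (b : EB) : int :=
  match nat_of_ord b with 0 => -1 | 1 | 2 => 0 | _ => 1 end.

Definition homogE (k : int) (x : EE) : Prop :=
  forall b, b \in dom x -> degE b = k.

(* Graded Lie bracket of E(b) on basis elements: it extends [e1,e2] = 2e1
   by the Leibniz rule; the only nonzero brackets are
   [e1,e2] = 2 e1, [e2,e1] = -2 e1,
   [e2, e1/\e2] = [e2,e1]/\e2 = -2 e1/\e2,  [e1/\e2, e2] = 2 e1/\e2
   (brackets with wedge^0 b = K vanish, [e1, e1/\e2] = 0, and
   [e1/\e2, e1/\e2] lies in wedge^3 b = 0). *)
Definition brE (b c : EB) : EE :=
  match nat_of_ord b, nat_of_ord c with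
  | 1, 2 => 2%:R *: bE Ee1
  | 2, 1 => - 2%:R *: bE Ee1
  | 2, 3 => - 2%:R *: bE Ew
  | 3, 2 => 2%:R *: bE Ew
  | _, _ => 0
  end.

(* L_infinity morphisms E(b) ~> D, in the standard (Kontsevich)        *)
(* formulation: a morphism of the codifferential cofree coalgebras     *)
(* S^c(E(b)[1]) -> S^c(D[1]).  We work with shifted degrees            *)
(* |s x| = deg x - 1 and the decalage structure maps                   *)
(*   q1 (s x) = - s(d x),   q2 (s x, s y) = (-1)^{deg x} s [x, y].     *)
(* A component F_n : S^n(E(b)[1]) -> D[1] is multilinear, hence given  *)
(* by its values F [:: b_1; ...; b_n] on basis elements.               *)
Definition sdegE (b : EB) : int := degE b - 1.

Definition q1D (x : DD) : DD := - dD x.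
Definition q2D (x y : DD) : DD :=
  bilin (fun m1 m2 => sgn (degM m1) *: gbr_mon m1 m2) x y.
Definition q2E (b c : EB) : EE := sgn (degE b) *: brE b c.

Fixpoint mlext (xs : seq EE) (F : seq EB -> DD) {struct xs} : DD :=
  match xs with
  | [::] => F [::]
  | x :: xs' => fglift (fun b => mlext xs' (fun bs => F (b :: bs))) x
  end.

(* unshuffles of bs are indexed by the subset S of positions forming the
   first block (in increasing order); the rest is the second block *)
Definition inS (bs : seq EB) (S : {set 'I_(size bs)}) : bitseq :=
  [seq (i \in S) | i <- enum 'I_(size bs)].
Definition blk1 (bs : seq EB) (S : {set 'I_(size bs)}) : seq EB :=
  mask (inS S) bs.
Definition blk2 (bs : seq EB) (S : {set 'I_(size bs)}) : seq EB :=
  mask (map negb (inS S)) bs.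

Definition ksign (bs : seq EB) (S : {set 'I_(size bs)}) : K :=
  \prod_(i < size bs) \prod_(j < size bs | (i < j)%N && (i \notin S) && (j \in S))
     sgn (sdegE (nth Eone bs i) * sdegE (nth Eone bs j)).

Definition swap_at (bs : seq EB) (i : nat) : seq EB :=
  take i bs ++ [:: nth Eone bs i.+1; nth Eone bs i] ++ drop i.+2 bs.

Definition Linf_morphism (F : seq EB -> DD) : Prop :=
  (* F_n has degree 0 from E(b)[1]^{n} to D[1], i.e. F_n(b_1..b_n) has
     (unshifted) degree sum_i deg b_i + 1 - n *)
  (forall bs, (0 < size bs)%N ->
      homogD ((\sum_(b <- bs) sdegE b) + 1) (F bs)) /\
  (forall bs i, (i.+1 < size bs)%N ->
      F (swap_at bs i) =
      sgn (sdegE (nth Eone bs i) * sdegE (nth Eone bs i.+1)) *: F bs) /\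
  (* compatibility with the codifferentials (q1 = 0 on E(b)) *)
  (forall bs, (0 < size bs)%N ->
      q1D (F bs)
      + 2%:R^-1 *: \sum_(S : {set 'I_(size bs)} | (0 < #|S| < size bs)%N)
           ksign S *: q2D (F (blk1 S)) (F (blk2 S))
      = \sum_(S : {set 'I_(size bs)} | #|S| == 2%N)
           ksign S *:
             mlext (q2E (nth Eone (blk1 S) 0) (nth Eone (blk1 S) 1)
                    :: map bE (blk2 S)) F).

Definition Lin1 (F : seq EB -> DD) (x : EE) : DD := fglift (fun b => F [:: b]) x.

Definition quasi_iso (F : seq EB -> DD) : Prop :=
  (forall k (x : EE), homogE k x ->
      (exists y : DD, Lin1 F x = dD y) -> x = 0) /\
  (forall k (z : DD), homogD k z -> dD z = 0 ->
      exists x : EE, homogE k x /\ exists y : DD, z = Lin1 F x + dD y).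

End DrinfeldBorel.

(* Main.v *)
Require Import Defs.
From HB Require Import structures.
From mathcomp Require Import all_boot all_order all_algebra.
From mathcomp Require Import freeg.
From mathcomp Require Import ring zify.

Set Implicit Arguments.
Unset Strict Implicit.
Unset Printing Implicit Defensive.

Import GRing.Theory.
Local Open Scope ring_scope.

(* A formal Maurer-Cartan element of the Drinfeld DGLA is a twist J = 1 + R with
   (Delta (x) 1)(J) (J (x) 1) = (1 (x) Delta)(J) (1 (x) J).  For b the Jordanian
   twist J = sum_n h^n binom(e2/2, n) (x) e1^n is one with leading term
   (e2 (x) e1)/2, so its coefficients give the values of the L-infinity morphism
   on (e1 /\ e2)^n.  The element log(1 + h e1)/h is primitive for the twisted
   coproduct, which gives the values on e1 (e1 /\ e2)^n; since e2 acts on the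
   twist as -2 h d/dh, no correction is needed for e2.  For degree reasons there
   are no further components, and all the structure equations reduce to the
   Vandermonde identity for falling factorials.

   The equations in U_b^{(x) n} are checked by evaluating ordered monomials at
   points of K^(2n), which is faithful because K is infinite; a coproduct then
   becomes the addition of arguments, a product the shift e2 -> e2 - 2c.

   As a complex, the DGLA is the cobar complex of the symmetric coalgebra on two
   generators, whose cohomology is computed by dimension shifting along the
   Koszul resolution. *)

(** In closed form J = exp(e2/2 (x) log(1 + h e1)). Evaluated with y in place of e2 in the first
    factor and x in place of e1 in the second, J becomes (1 + h x)^(y/2), and each identity between
    falling factorials is n! times the coefficient of h^n in an identity between powers and
    logarithms of such series. The factor 1/2 is forced by e2 e1 = e1 (e2 - 2): moving e1^k to the
    left lowers e2/2 by the integer k, so falling factorials stay falling factorials. The leading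
    term need not be the antisymmetrised e1 /\ e2, because rescaling e1 /\ e2 is an automorphism of
    E(b): any nonzero multiple of its class will do.

    After the shift e1 /\ e2 has degree 0 and commutes with everything without sign. By symmetry the
    structure equations need checking only on a few other basis elements followed by n copies of e1
    /\ e2, where sums over unshuffles become binomial sums; this is why the components are n! times
    the coefficients of h^n. On (e1, e2) or on 1, followed by copies of e1 /\ e2, the degree leaves
    room only for scalars; they are taken to be zero, except that 1 itself goes to the unit of
    D^(-1). *)

(** * Linear extension from a basis of a free module *)

Section FreegLift.
Variables (K : fieldType) (T : choiceType).
Implicit Types (x y : {freeg T / K}).

Lemma freeg_scaleU (c : K) (t : T) :
  [freeg [:: (c, t)]] = c *: [freeg [:: (1, t)]] :> {freeg T / K}.
Proof. by apply/eqP/freeg_eqP => s; rewrite coeffZ !coeffU mul1r. Qed.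

Lemma freeg_expand x :
  x = \sum_(t <- dom x) coeff t x *: [freeg [:: (1, t)]].
Proof. by rewrite -{1}[x]freeg_sumE; apply: eq_bigr => t _; apply: freeg_scaleU. Qed.

Variable (M : lmodType K).

Lemma fglift_is_linear (f : T -> M) : linear (fglift f : {freeg T / K} -> M).
Proof.
have fB := lift_is_additive f.
have f0 : fglift f 0 = 0 by rewrite -[0 in LHS](subrr (0 : {freeg T / K})) fB subrr.
have fD x y : fglift f (x + y) = fglift f x + fglift f y.
  by rewrite -[y in LHS]opprK fB -[- y]sub0r fB f0 sub0r opprK.
move=> c x y; rewrite fD; suff -> : fglift f (c *: x) = c *: fglift f x by [].
elim/freeg_ind_dom0: x => [|k t x _ _ IH]; first by rewrite scaler0 f0 scaler0.
by rewrite scalerDr !fD IH scalerDr freeg_scaleU scalerA -!freeg_scaleU !liftU scalerA.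
Qed.

HB.instance Definition _ (f : T -> M) :=
  GRing.isLinear.Build K {freeg T / K} M _ (fglift f) (fglift_is_linear f).

Lemma fglift1 (f : T -> M) t : fglift f [freeg [:: (1, t)]] = f t.
Proof. by rewrite liftU scale1r. Qed.

Lemma fgliftE (f : T -> M) x : fglift f x = \sum_(t <- dom x) coeff t x *: f t.
Proof.
rewrite {1}(freeg_expand x) linear_sum; apply: eq_bigr => t _.
by rewrite linearZ /= fglift1.
Qed.

Lemma eq_fglift_dom (f g : T -> M) x :
  {in dom x, f =1 g} -> fglift f x = fglift g x.
Proof. by move=> fg; rewrite !fgliftE; apply: eq_big_seq => t /fg ->. Qed.

Lemma eq_fglift (f g : T -> M) x : f =1 g -> fglift f x = fglift g x.
Proof. by move=> fg; apply: eq_fglift_dom. Qed.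

Lemma fglift_sum (I : Type) (s : seq I) (P : pred I) (f : I -> T -> M) x :
  fglift (fun t => \sum_(i <- s | P i) f i t) x = \sum_(i <- s | P i) fglift (f i) x.
Proof.
under eq_bigr => i _ do rewrite fgliftE.
rewrite fgliftE exchange_big /=; apply: eq_bigr => t _; exact: scaler_sumr.
Qed.

Lemma fgliftB (f g : T -> M) x :
  fglift (fun t => f t - g t) x = fglift f x - fglift g x.
Proof. by rewrite !fgliftE -sumrB; apply: eq_bigr => t _; rewrite scalerBr. Qed.

Lemma fgliftD (f g : T -> M) x :
  fglift (fun t => f t + g t) x = fglift f x + fglift g x.
Proof. by rewrite !fgliftE -big_split; apply: eq_bigr => t _; rewrite scalerDr. Qed.

Lemma fgliftZ (c : K) (f : T -> M) x :
  fglift (fun t => c *: f t) x = c *: fglift f x.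
Proof. by rewrite !fgliftE scaler_sumr; apply: eq_bigr => t _; rewrite !scalerA mulrC. Qed.

Lemma fglift_0 x : fglift (fun=> 0 : M) x = 0.
Proof. by rewrite fgliftE big1 // => t _; rewrite scaler0. Qed.

End FreegLift.

Lemma linear_fglift (K : fieldType) (T : choiceType) (M N : lmodType K)
    (h : {linear M -> N}) (f : T -> M) (x : {freeg T / K}) :
  h (fglift f x) = fglift (h \o f) x.
Proof.
by rewrite !fgliftE linear_sum; apply: eq_bigr => t _; rewrite linearZ.
Qed.

Lemma fglift_id (K : fieldType) (T : choiceType) (x : {freeg T / K}) :
  fglift (fun t => [freeg [:: (1, t)]] : {freeg T / K}) x = x.
Proof. by rewrite fgliftE -freeg_expand. Qed.

Lemma coeff_fglift (K : fieldType) (T S : choiceType) (f : T -> {freeg S / K}) s x :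
  coeff s (fglift f x) = \sum_(t <- dom x) coeff t x * coeff s (f t).
Proof.
by rewrite fgliftE raddf_sum; apply: eq_bigr => t _; rewrite /= coeffZ.
Qed.

Lemma coeff_expand (K : fieldType) (T : choiceType) s (x : {freeg T / K}) :
  coeff s x = \sum_(t <- dom x) coeff t x * (t == s)%:R.
Proof. exact: (@fgliftE K T K^o). Qed.

(** * Evaluation of tensors at points, and its faithfulness *)

Section Evaluation.
Variable K : fieldType.
Hypothesis charK0 : [pchar K] =i pred0.
Local Notation D := (DD K).
Local Notation bD := (bD K).

Lemma natr_inj_pchar0 (m n : nat) : m%:R = n%:R :> K -> m = n.
Proof.
wlog le_mn : m n / (m <= n)%N => [H|] e.
  by case/orP: (leq_total m n) => /H -> //; apply: esym.
have /eqP : (n - m)%:R = 0 :> K by rewrite natrB // e subrr.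
by rewrite (pcharf0P K).1 // subn_eq0 => le_nm; apply/eqP; rewrite eqn_leq le_mn.
Qed.

Lemma poly_eval_eq0 (p : {poly K}) : (forall a, p.[a] = 0) -> p = 0.
Proof.
move=> p0; apply/eqP; apply: contraT => nzp.
have := max_poly_roots (rs := [seq i%:R | i <- iota 0 (size p)]) nzp.
rewrite size_map size_iota ltnn; apply.
  by apply/allP => a _; apply/eqP/p0.
by rewrite map_inj_uniq ?iota_uniq //; apply: natr_inj_pchar0.
Qed.

(** A polynomial function that vanishes on an infinite field has zero coefficients; exponents may
    repeat, so a coefficient is itself a sum. *)
Lemma sum_pow_eq0 (I : Type) (s : seq I) (c : I -> K) (k : I -> nat) :
    (forall a, \sum_(i <- s) c i * a ^+ k i = 0) ->
  forall j, \sum_(i <- s | k i == j) c i = 0.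
Proof.
move=> s0 j; have p0 : \sum_(i <- s) c i *: 'X^(k i) = 0.
  apply: poly_eval_eq0 => a; rewrite horner_sum -[RHS](s0 a).
  by apply: eq_bigr => i _; rewrite hornerZ hornerXn.
rewrite -[RHS](coef0 K j) -p0 coef_sum big_mkcond; apply: eq_bigr => i _.
by rewrite coefZ coefXn eq_sym; case: eqP; rewrite ?mulr1 ?mulr0.
Qed.

(** The value 0 on a length mismatch makes evaluation at [v] see only the tensor power of order
    [size v], so one family of functionals serves the whole direct sum. *)
Fixpoint evm (v : seq (K * K)) (m : Mon) : K :=
  match v, m with
  | [::], [::] => 1
  | w :: v', p :: m' => w.1 ^+ p.1 * w.2 ^+ p.2 * evm v' m'
  | _, _ => 0
  end.

Definition EV (v : seq (K * K)) : D -> K^o := fglift (evm v : Mon -> K^o).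

HB.instance Definition _ v :=
  GRing.isLinear.Build K D K^o _ (EV v) (@fglift_is_linear K Mon K^o (evm v)).

Lemma EV1 v m : EV v (bD m) = evm v m.
Proof. exact: (@fglift1 K Mon K^o). Qed.

Lemma EVE v x : EV v x = \sum_(m <- dom x) coeff m x * evm v m.
Proof. exact: (@fgliftE K Mon K^o). Qed.

(** Induction on a bound for the tensor lengths: as a polynomial in the first pair of variables, an
    evaluation of [x] has as coefficients the evaluations of the parts of [x] with a prescribed
    first factor, stripped of that factor. *)
Lemma EV_eq0 (x : D) : (forall v, EV v x = 0) -> x = 0.
Proof.
have [N ltN] : exists N, forall m, m \in dom x -> (size m < N)%N.
  exists (\max_(m <- dom x) size m).+1 => m mx.
  by rewrite ltnS; apply: (leq_bigmax_seq (P := xpredT)).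
elim: N x ltN => [|N IH] x ltN x0.
  by apply/eqP; rewrite -dom_eq0; case: (dom x) ltN => [|m s /(_ m)] //; rewrite inE eqxx => /(_ isT).
apply/eqP/freeg_eqP => -[|p m]; rewrite coeff0.
  have := x0 [::]; rewrite EVE => <-; case: (boolP ([::] \in dom x)) => [in_x|out_x].
    rewrite (bigD1_seq [::]) ?uniq_dom //= mulr1 big1 ?addr0 // => -[] // ? ? _.
    by rewrite mulr0.
  rewrite coeff_outdom // big_seq big1 // => -[|? ?] /=; rewrite ?mulr0 //.
  by rewrite (negPf out_x).
pose hd (m : Mon) := head (0, 0)%N m.
pose strip (q : Mon) : D := if (q != [::]) && (hd q == p) then bD (behead q) else 0.
suff /(congr1 (coeff m)) : fglift strip x = 0.
  rewrite coeff0 => <-.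
  rewrite coeff_fglift coeff_expand; apply: eq_bigr => -[|q m'] _; rewrite /strip /=.
    by rewrite coeff0.
  rewrite eqseq_cons; case: eqP => _ /=; last by rewrite coeff0.
  by rewrite coeffU mul1r.
apply: IH => [q|v].
  move=> qx; have [m' m'x /andP[hm' qm']] : exists2 m', m' \in dom x & (m' != [::]) && (q == behead m').
    apply/hasP; apply: contraLR qx => /hasPn out.
    rewrite mem_dom negbK coeff_fglift big_seq big1 // => m' /out /=.
    rewrite /strip; case: (m' != [::]) => /=; last by rewrite coeff0 mulr0.
    by case: (_ == p); rewrite ?coeff0 ?mulr0 // coeffU eq_sym => /negPf ->; rewrite !mulr0.
  by rewrite (eqP qm') size_behead; have := ltN _ m'x; case: (m') hm'.
rewrite linear_fglift /= fgliftE.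
pose c m := (m != [::])%:R * coeff m x * evm v (behead m).
(* The first point (a, b) varies while the tail [v] is fixed; coefficients are then compared in a
   and afterwards in b. *)
have c0 a b : \sum_(m <- dom x) c m * b ^+ (hd m).2 * a ^+ (hd m).1 = 0.
  rewrite -[RHS](x0 ((a, b) :: v)) EVE; apply: eq_bigr => -[|q m'] _ /=.
    by rewrite /c /= !mul0r mulr0.
  by rewrite /c /=; ring.
have {}c0 b j1 : \sum_(m <- dom x | (hd m).1 == j1) c m * b ^+ (hd m).2 = 0.
  by apply: sum_pow_eq0 => a; apply: c0.
have {}c0 j1 j2 : \sum_(m <- dom x | ((hd m).1 == j1) && ((hd m).2 == j2)) c m = 0.
  rewrite -big_filter_cond; apply: sum_pow_eq0 => b; rewrite big_filter; exact: c0.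
rewrite -[RHS](c0 p.1 p.2) [RHS]big_mkcond; apply: eq_bigr => -[|q m'] _; rewrite /strip /c /=.
  by rewrite linear0 scaler0 !mul0r if_same.
rewrite -pair_eqE /pair_eq /=.
by case: ifP => _; rewrite ?EV1 ?linear0 ?scaler0 ?mul1r.
Qed.

Lemma EV_inj (x y : D) : (forall v, EV v x = EV v y) -> x = y.
Proof.
by move=> xy; apply/subr0_eq/EV_eq0 => v; rewrite linearB /= xy subrr.
Qed.

Lemma EV_fglift v (T : choiceType) (f : T -> D) x :
  EV v (fglift f x) = fglift (fun t => EV v (f t)) x.
Proof. exact: linear_fglift. Qed.

End Evaluation.

(** * Product, coproduct, composition and differential under evaluation *)

Section EvaluationOfOperations.
Variable K : fieldType.
Local Notation D := (DD K).
Local Notation bD := (bD K).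

Implicit Types (v : seq (K * K)) (w : K * K) (m : Mon) (p q : nat * nat).

Definition addp (w w' : K * K) : K * K := (w.1 + w'.1, w.2 + w'.2).
(** Right multiplication by e1^c e2^d pulls e1^c to the left through the powers of e2, each e2
    turning into e2 - 2c. *)
Definition shp (w : K * K) (q : nat * nat) : K * K := (w.1, w.2 - (2 * q.1)%:R).

Fixpoint shift (v : seq (K * K)) (m : Mon) : seq (K * K) :=
  match v, m with
  | w :: v', q :: m' => shp w q :: shift v' m'
  | _, _ => [::]
  end.

Lemma evm_size v m : size v != size m -> evm v m = 0.
Proof.
elim: v m => [|w v IH] [|p m] //=; rewrite eqSS => /IH ->; exact: mulr0.
Qed.

Lemma EV_umul1 w v p q (y : D) :
  EV (w :: v) (tens (umul1 K p q) y) =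
  w.1 ^+ p.1 * (shp w q).2 ^+ p.2 * (w.1 ^+ q.1 * w.2 ^+ q.2) * EV v y.
Proof.
rewrite /umul1 /tens /bilin linear_sum linear_sum /=.
rewrite addrC exprDn mulr_sumr !mulr_suml; apply: eq_bigr => j _.
rewrite !linearZ /= fglift1 EV_fglift.
rewrite (eq_fglift (g := fun m' => (w.1 ^+ (p.1 + q.1) * w.2 ^+ (j + q.2)) *: (evm v m' : K^o))); last first.
  by move=> m'; rewrite EV1.
rewrite fgliftZ -/(EV v y) !exprD /GRing.scale /= -mulr_natl.
ring.
Qed.

Lemma EV_umul1_nil p q (y : D) : EV [::] (tens (umul1 K p q) y) = 0.
Proof.
rewrite /umul1 /tens /bilin linear_sum linear_sum /= big1 // => j _.
rewrite !linearZ /= fglift1 EV_fglift.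
rewrite (eq_fglift (g := fun _ => 0 : K^o)) ?fglift_0 ?scaler0 // => m'.
exact: EV1.
Qed.

Lemma EV_umul_mon v m m' :
  EV v (umul_mon K m m') = evm (shift v m') m * evm v m'.
Proof.
rewrite /umul_mon; case: eqP => [|/eqP ne].
  elim: v m m' => [|w v IH] [|p m] [|q m'] //= e.
  - by rewrite EV1 mulr1.
  - by rewrite EV_umul1_nil mul0r.
  - by rewrite EV1 mulr0.
  - by rewrite EV_umul1 IH; [ring | case: e].
rewrite linear0; case: (eqVneq (size v) (size m')) => [e|/evm_size ->]; last by rewrite mulr0.
rewrite evm_size ?mul0r //; suff -> : size (shift v m') = size m' by rewrite eq_sym.
by elim: v m' e {ne} => [|w v IH] [|q m'] //= [/IH] ->.
Qed.

(** The shift depends on the e1-exponents of the right factor, which is therefore a monomial while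
    the left one is arbitrary. *)
Lemma EV_umul v (x : D) m' : EV v (umul x (bD m')) = EV (shift v m') x * evm v m'.
Proof.
rewrite /umul /bilin EV_fglift mulrC -[evm v m' * _]/(_ *: EV _ x) -fgliftZ.
by apply: eq_fglift => m; rewrite fglift1 EV_umul_mon mulrC.
Qed.

(** Since e1 and e2 are primitive, the coproduct of a function of w is that function of w + w'.
    [None] marks a point with too few entries, where the evaluation is 0. *)
Fixpoint mrg (l : nat) (v : seq (K * K)) : option (seq (K * K)) :=
  match l, v with
  | 0, w :: w' :: v' => Some (addp w w' :: v')
  | l'.+1, w :: v' => omap (cons w) (mrg l' v')
  | _, _ => None
  end.

Definition oevm (ov : option (seq (K * K))) (m : Mon) : K :=
  if ov is Some v then evm v m else 0.

Lemma delta_at_monS l p m :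
  delta_at_mon K l.+1 (p :: m) = fglift (fun m' => bD (p :: m')) (delta_at_mon K l m).
Proof.
rewrite /delta_at_mon /= ltnS; case: ltnP => _; last by rewrite linear0.
rewrite linear_sum; apply: eq_bigr => i _; rewrite linear_sum; apply: eq_bigr => j _.
by rewrite linearZ /= fglift1.
Qed.

Lemma EV_delta_at_mon l v m : EV v (delta_at_mon K l m) = oevm (mrg l v) m.
Proof.
elim: l v m => [|l IH] v m.
  case: m => [|p m]; first by rewrite linear0; case: v => [|w [|w' v]].
  rewrite /delta_at_mon /= linear_sum /=.
  case: v => [|w [|w' v]] /=.
  - by rewrite big1 // => i _; rewrite linear_sum big1 // => j _; rewrite linearZ /= EV1 scaler0.
  - rewrite big1 // => i _; rewrite linear_sum big1 // => j _.
    by rewrite linearZ /= EV1 /= mulr0 scaler0.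
  rewrite addrC exprDn [w.2 + _]addrC exprDn !mulr_suml; apply: eq_bigr => i _.
  rewrite linear_sum /= -mulrA mulr_suml mulr_sumr; apply: eq_bigr => j _.
  rewrite linearZ /= EV1 /= drop0 /GRing.scale /= natrM -[(_ * _) *+ 'C(_, i)]mulr_natl -[(_ * _) *+ 'C(_, j)]mulr_natl.
  ring.
case: m => [|p m].
  by rewrite linear0; case: v => [|w v] //=; case: (mrg _ _).
rewrite delta_at_monS EV_fglift; case: v => [|w v] /=.
  by rewrite (eq_fglift (g := fun _ => 0 : K^o)) ?fglift_0 // => t; apply: EV1.
rewrite (eq_fglift (g := fun t => (w.1 ^+ p.1 * w.2 ^+ p.2) *: (evm v t : K^o))); last first.
  by move=> t; rewrite EV1.
rewrite fgliftZ /= -/(EV v _) IH.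
by case: (mrg l v) => [v'|] //=; rewrite scaler0.
Qed.

Lemma EV_delta_at l v m : EV v (delta_at l (bD m)) = oevm (mrg l v) m.
Proof. by rewrite /delta_at fglift1 EV_delta_at_mon. Qed.

Lemma umul0l (y : D) : umul 0 y = 0.
Proof. exact: linear0. Qed.

Lemma circ_nil_l m : circ_mon K [::] m = 0.
Proof. by rewrite /circ_mon big_ord0. Qed.

Lemma circ11 p q : circ_mon K [:: p] [:: q] = umul (bD [:: p]) (bD [:: q]).
Proof. by rewrite /circ_mon big_ord_recl big_ord0 addr0 scale1r. Qed.

Lemma circ12 p q1 q2 :
  circ_mon K [:: p] [:: q1; q2] = umul (delta_at 0 (bD [:: p])) (bD [:: q1; q2]).
Proof. by rewrite /circ_mon big_ord_recl big_ord0 addr0 scale1r. Qed.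

Lemma circ21 p1 p2 q :
  circ_mon K [:: p1; p2] [:: q] =
  umul (bD [:: p1; p2]) (bD [:: q; (0, 0)%N]) + umul (bD [:: p1; p2]) (bD [:: (0, 0)%N; q]).
Proof. by rewrite /circ_mon !big_ord_recl big_ord0 addr0 !scale1r. Qed.

Lemma circ22 p1 p2 q1 q2 :
  circ_mon K [:: p1; p2] [:: q1; q2] =
  umul (delta_at 0 (bD [:: p1; p2])) (bD [:: q1; q2; (0, 0)%N])
  - umul (delta_at 1 (bD [:: p1; p2])) (bD [:: (0, 0)%N; q1; q2]).
Proof. by rewrite /circ_mon !big_ord_recl big_ord0 addr0 scale1r scaleN1r. Qed.

Lemma circ10 p : circ_mon K [:: p] [::] = (p == (0, 0)%N)%:R *: bD [::].
Proof.
rewrite /circ_mon big_ord_recl big_ord0 addr0 scale1r /= /eps_at fglift1 /eps_at_mon /=.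
case: eqP => _; last by rewrite umul0l scale0r.
by rewrite scale1r /umul /bilin !fglift1.
Qed.

Lemma circ20 p1 p2 : p1 != (0, 0)%N -> p2 != (0, 0)%N ->
  circ_mon K [:: p1; p2] [::] = 0.
Proof.
move=> /negPf n1 /negPf n2.
rewrite /circ_mon !big_ord_recl big_ord0 addr0 /= /eps_at !fglift1 /eps_at_mon /= n1 n2.
by rewrite umul0l !scaler0 addr0.
Qed.

Lemma EV_dD1 v p : EV v (dD_mon K [:: p]) =
  if v is [:: w1; w2] then evm [:: w1] [:: p] + evm [:: w2] [:: p]
     - evm [:: addp w1 w2] [:: p] else 0.
Proof.
rewrite /dD_mon big_ord_recl big_ord0 addr0 !scale1r linearD linearB /= !EV1 EV_delta_at.
by case: v => [|w1 [|w2 [|w3 v]]] /=; rewrite ?expr0 ?mul1r ?mulr1 ?mulr0 ?subr0 ?addr0 // addrAC.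
Qed.

Lemma EV_dD2 v p1 p2 : EV v (dD_mon K [:: p1; p2]) =
  if v is [:: w1; w2; w3] then
    evm [:: w1; w2] [:: p1; p2] + evm [:: addp w1 w2; w3] [:: p1; p2]
    - evm [:: w1; addp w2 w3] [:: p1; p2] - evm [:: w2; w3] [:: p1; p2] else 0.
Proof.
rewrite /dD_mon !big_ord_recl big_ord0 !addr0 !scale1r !scaleN1r linearD linearB /=.
rewrite linearN linearD linearN /= !EV1 (EV_delta_at 0) (EV_delta_at 1).
by case: v => [|w1 [|w2 [|w3 [|w4 v]]]] /=; ring.
Qed.

End EvaluationOfOperations.

(** * Sums weighted by binomial coefficients *)

Section BinomialSums.

Lemma sum_binS (M : zmodType) (h : nat -> M) n :
  \sum_(j < n.+2) h j *+ 'C(n.+1, j) =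
  \sum_(j < n.+1) h j *+ 'C(n, j) + \sum_(j < n.+1) h j.+1 *+ 'C(n, j).
Proof.
rewrite big_ord_recl; under eq_bigr => j _ do rewrite binS mulrnDr.
rewrite big_split addrA /=; congr (_ + _).
rewrite [RHS]big_ord_recl [X in _ + X = _]big_ord_recr /= (bin_small (ltnSn n)) mulr0n addr0 !bin0.
by congr (_ + _); apply: eq_bigr.
Qed.

Lemma sum_bin_widen (M : zmodType) (h : nat -> M) n N : (n < N)%N ->
  \sum_(j < n.+1) h j *+ 'C(n, j) = \sum_(j < N) h j *+ 'C(n, j).
Proof.
move=> ltnN; rewrite (big_ord_widen N (fun j => h j *+ 'C(n, j))) // big_mkcond.
by apply: eq_bigr => j _; case: ltnP => // /bin_small ->.
Qed.

(** Both sides count the ordered pairs of disjoint subsets of sizes k and l; for k + l > n both are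
    0, also where the subtraction truncates. *)
Lemma bin_trinomial n k l : ('C(n, k) * 'C(n - k, l) = 'C(n, l) * 'C(n - l, k))%N.
Proof.
have out i j : (n < i + j)%N -> ('C(n, i) * 'C(n - i, j) = 0)%N.
  have [le_in|lt_ni] := leqP i n => lt_n; last by rewrite bin_small.
  by rewrite [X in (_ * X)%N]bin_small ?muln0 //; lia.
have [le_n|lt_n] := leqP (k + l) n; last by rewrite !out // addnC.
have fpos : (0 < k`! * l`! * (n - k - l)`!)%N by rewrite !muln_gt0 !fact_gt0.
apply/eqP; rewrite -(eqn_pmul2r fpos); apply/eqP.
have e1 : ('C(n, k) * (k`! * (n - k)`!) = n`!)%N by apply: bin_fact; lia.
have e2 : ('C(n - k, l) * (l`! * (n - k - l)`!) = (n - k)`!)%N by apply: bin_fact; lia.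
have e3 : ('C(n, l) * (l`! * (n - l)`!) = n`!)%N by apply: bin_fact; lia.
have e4 : ('C(n - l, k) * (k`! * (n - k - l)`!) = (n - l)`!)%N.
  by rewrite subnAC; apply: bin_fact; lia.
transitivity n`!; [rewrite -e1 -e2 | rewrite -e3 -e4]; ring.
Qed.

End BinomialSums.

(** * Falling factorials, the twist equation and the logarithm *)

Section FallingFactorial.
Variable K : fieldType.
Implicit Types (a b x y z Y : K).

Definition ff z n : K := \prod_(i < n) (z - i%:R).

Lemma ff0 z : ff z 0 = 1. Proof. by rewrite /ff big_ord0. Qed.

Lemma ffS z n : ff z n.+1 = ff z n * (z - n%:R).
Proof. by rewrite /ff big_ord_recr. Qed.

Lemma ffD z m n : ff z (m + n) = ff z m * ff (z - m%:R) n.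
Proof.
elim: n => [|n IH]; first by rewrite addn0 ff0 mulr1.
by rewrite addnS !ffS IH natrD; ring.
Qed.

Lemma ff_Vandermonde a b n :
  ff (a + b) n = \sum_(j < n.+1) (ff a j * ff b (n - j)) *+ 'C(n, j).
Proof.
elim: n => [|n IH]; first by rewrite big_ord1 !ff0 mulr1.
rewrite (sum_binS (fun j => ff a j * ff b (n.+1 - j))) -big_split ffS IH mulr_suml /=.
apply: eq_bigr => j _; rewrite -mulrnDl subSS subSn -1?ltnS // !ffS mulrnAl; congr (_ *+ _).
by rewrite natrB -1?ltnS //; ring.
Qed.

Lemma ff_Vandermonde_widen a b n N : (n < N)%N ->
  ff (a + b) n = \sum_(j < N) (ff a j * ff b (n - j)) *+ 'C(n, j).
Proof. by move/(sum_bin_widen (fun j => ff a j * ff b (n - j))) <-; apply: ff_Vandermonde. Qed.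

(** This is n! times the coefficient of h^n in the evaluated twist equation. In closed form both
    sides are (1 + h(x2 + x3))^Y1 (1 + h x3)^Y2, by 1 + h x2 / (1 + h x3) = (1 + h(x2 + x3)) / (1 +
    h x3). *)
Lemma twist_identity Y1 Y2 x2 x3 n :
  \sum_(k < n.+1) (ff (Y1 + Y2 - k%:R) (n - k) * x3 ^+ (n - k) * (ff Y1 k * x2 ^+ k)
      - ff Y1 (n - k) * (x2 + x3) ^+ (n - k) * (ff Y2 k * x3 ^+ k)) *+ 'C(n, k) = 0.
Proof.
under eq_bigr => k _ do rewrite mulrnBl.
rewrite sumrB; apply/eqP; rewrite subr_eq0; apply/eqP.
have bin_xy k : (k < n.+1)%N -> (x2 + x3) ^+ (n - k) =
    \sum_(l < n.+1) (x2 ^+ l * x3 ^+ (n - k - l)) *+ 'C(n - k, l).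
  move=> lek; rewrite addrC exprDn (sum_bin_widen (fun l => x3 ^+ (n - k - l) * x2 ^+ l) (N := n.+1)) ?ltnS ?leq_subr //.
  by apply: eq_bigr => l _; rewrite mulrC.
(* Common expansion of both products: Vandermonde applied to Y2 + (Y1 - k) on the left, the binomial
   theorem for x2 + x3 on the right. *)
transitivity (\sum_(k < n.+1) \sum_(l < n.+1)
    ff Y1 (n - l) * ff Y2 l * x2 ^+ k * x3 ^+ (n - k) *+ ('C(n, k) * 'C(n - k, l))).
  apply: eq_bigr => k _.
  rewrite addrAC addrC (@ff_Vandermonde_widen _ _ _ n.+1) ?ltnS ?leq_subr //.
  rewrite !mulr_suml -sumrMnl; apply: eq_bigr => l _.
  have [lel|ltl] := leqP l (n - k); last by rewrite bin_small // muln0 !mulr0n !mul0r mul0rn.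
  have -> : (n - l = k + (n - k - l))%N by move: lel (ltn_ord k); lia.
  by rewrite ffD !mulrnAl mulnC mulrnA; congr (_ *+ _ *+ _); ring.
rewrite exchange_big; apply: eq_bigr => l _; rewrite bin_xy //.
rewrite mulr_sumr mulr_suml -sumrMnl; apply: eq_bigr => k _.
have [lel|ltl] := leqP k (n - l); last first.
  by rewrite bin_trinomial (bin_small ltl) muln0 !mulr0n mulr0 mul0r mul0rn.
have -> : x3 ^+ (n - k) = x3 ^+ (n - l - k) * x3 ^+ l.
  by rewrite -exprD; congr (_ ^+ _); move: lel (ltn_ord l); lia.
rewrite bin_trinomial mulnC mulrnA mulrnAr mulrnAl; congr (_ *+ _ *+ _); ring.
Qed.

Hypothesis charK0 : [pchar K] =i pred0.

Lemma natrS_neq0 n : n.+1%:R != 0 :> K.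
Proof. by rewrite (pcharf0P K).1. Qed.

Lemma factr_neq0 n : n`!%:R != 0 :> K.
Proof. by rewrite (pcharf0P K).1 // -lt0n fact_gt0. Qed.

Lemma ffN i j : ff (- i.+1%:R) j * i`!%:R = (-1) ^+ j * (i + j)`!%:R :> K.
Proof.
elim: j => [|j IH]; first by rewrite ff0 addn0 expr0.
rewrite ffS mulrAC IH addnS factS natrM exprS -[(i + j).+1]addSn natrD; ring.
Qed.

(* n! times the coefficient of h^n e^(n+1) in log(1 + h e) / h *)
Definition logc n : K := n`!%:R * (-1) ^+ n / n.+1%:R.

(** With a_k = [logc k] / k!, this compares the coefficients of x1^(i+1) x2^j: a_(i+j) C(i+j+1, i+1)
    comes from log(1 + h(x1 + x2)) / h, and a_i binom(-(i+1), j) from a_i x1^(i+1) (1 + h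
    x2)^(-(i+1)). *)
Lemma logc_bin n i j : (i + j <= n)%N ->
  'C(n, i + j)%:R * logc (i + j) * 'C((i + j).+1, i.+1)%:R =
  'C(n, i)%:R * logc i * ('C(n - i, j)%:R * ff (- i.+1%:R) j).
Proof.
move=> le_n; rewrite /logc.
have nz := factr_neq0.
have ffE : ff (- i.+1%:R) j = (-1) ^+ j * (i + j)`!%:R / i`!%:R.
  by rewrite -ffN mulfK.
have e1 : 'C(n, i + j)%:R = n`!%:R / ((i + j)`!%:R * (n - (i + j))`!%:R) :> K.
  by rewrite -(bin_fact le_n) !natrM mulfK // mulf_neq0.
have e2 : 'C((i + j).+1, i.+1)%:R = (i + j).+1%:R * (i + j)`!%:R / (i.+1%:R * i`!%:R * j`!%:R) :> K.
  have le : (i < (i + j).+1)%N by rewrite ltnS leq_addr.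
  apply: (canRL (mulfK _)); first by rewrite !mulf_neq0 ?natrS_neq0 ?nz.
  by rewrite -!natrM -!factS -(bin_fact le) subSS addKn -mulnA.
have e3 : 'C(n, i)%:R = n`!%:R / (i`!%:R * (n - i)`!%:R) :> K.
  by rewrite -(@bin_fact n i) ?natrM ?mulfK ?mulf_neq0 //; lia.
have e4 : 'C(n - i, j)%:R = (n - i)`!%:R / (j`!%:R * (n - (i + j))`!%:R) :> K.
  by rewrite -(@bin_fact (n - i) j) ?subnDA ?natrM ?mulfK ?mulf_neq0 //; lia.
rewrite e1 e2 e3 e4 ffE exprD; field.
by rewrite !nz -natrD !nat1r !natrS_neq0.
Qed.

(** For a = log(1 + h e1)/h this is the h^n part, times n!, of Delta(a) J = J (a (x) 1 + 1 (x) a).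
    Divided by (1 + h x2)^Y it says log(1 + h(x1 + x2)) = log(1 + h x1 / (1 + h x2)) + log(1 + h
    x2). *)
Lemma log_identity Y x1 x2 n :
  \sum_(k < n.+1) (logc k * ((x1 + x2) ^+ k.+1 * (ff Y (n - k) * x2 ^+ (n - k))
     - ff (Y - k.+1%:R) (n - k) * x2 ^+ (n - k) * x1 ^+ k.+1
     - ff Y (n - k) * x2 ^+ (n - k) * x2 ^+ k.+1)) *+ 'C(n, k) = 0.
Proof.
have bin_xy k : (k < n.+1)%N -> (x1 + x2) ^+ k.+1 - x2 ^+ k.+1 =
    \sum_(i < n.+1) (x1 ^+ i.+1 * x2 ^+ (k - i)) *+ 'C(k.+1, i.+1).
  move=> lek; rewrite [x1 + x2]addrC exprDn (sum_bin_widen (fun l => x2 ^+ (k.+1 - l) * x1 ^+ l) (N := n.+2)) //.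
  rewrite big_ord_recl /= bin0 mulr1n expr0 mulr1 subn0 addrAC subrr add0r.
  by apply: eq_bigr => i _; rewrite mulrC subSS.
transitivity (\sum_(k < n.+1) \sum_(i < n.+1) 'C(n, k)%:R * logc k * 'C(k.+1, i.+1)%:R *
     (ff Y (n - k) * x2 ^+ (n - k) * x1 ^+ i.+1 * x2 ^+ (k - i))
   - \sum_(k < n.+1) 'C(n, k)%:R * logc k * (ff (Y - k.+1%:R) (n - k) * x2 ^+ (n - k) * x1 ^+ k.+1)).
  rewrite -sumrB; apply: eq_bigr => k _.
  transitivity ('C(n, k)%:R * logc k * (ff Y (n - k) * x2 ^+ (n - k) * ((x1 + x2) ^+ k.+1 - x2 ^+ k.+1)
     - ff (Y - k.+1%:R) (n - k) * x2 ^+ (n - k) * x1 ^+ k.+1)).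
    by rewrite -mulr_natl; ring.
  rewrite mulrBr bin_xy // mulr_sumr mulr_sumr; congr (_ - _).
  by apply: eq_bigr => i _; rewrite -mulr_natl; ring.
apply/eqP; rewrite subr_eq0 exchange_big; apply/eqP; apply: eq_bigr => i _.
have i_le : (i <= n)%N by rewrite -ltnS.
rewrite -(big_mkord xpredT (fun k => 'C(n, k)%:R * logc k * 'C(k.+1, i.+1)%:R *
     (ff Y (n - k) * x2 ^+ (n - k) * x1 ^+ i.+1 * x2 ^+ (k - i)))).
(* Only k >= i contributes to x1^(i+1). With k = i + j the sum becomes the Vandermonde expansion of
   the falling factorial at Y - (i + 1). *)
rewrite (big_cat_nat (n := i)) //= 1?ltnW // [X in X + _]big_nat_cond [X in X + _]big1 ?add0r; last first.
  by move=> k /andP[/andP[_ ltk] _]; rewrite (@bin_small k.+1 i.+1) ?ltnS // mulr0 mul0r.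
rewrite -{1}[nat_of_ord i]add0n big_addn big_mkord subSn //.
rewrite [Y - _]addrC ff_Vandermonde !mulr_suml mulr_sumr; apply: eq_bigr => j _.
have lej : (i + j <= n)%N by have := ltn_ord j; lia.
rewrite [(j + i)%N]addnC logc_bin // -mulr_natl -subnDA addKn.
have -> : x2 ^+ (n - i) = x2 ^+ (n - (i + j)) * x2 ^+ j by rewrite -exprD; congr (_ ^+ _); lia.
ring.
Qed.

End FallingFactorial.

(** * Brackets of the elements that occur as values of the morphism *)

Section Brackets.
Variable K : fieldType.
Local Notation D := (DD K).
Local Notation bD := (bD K).
Implicit Types (v : seq (K * K)) (w : K * K) (m : Mon) (p q : nat * nat) (x y : D).

Lemma q2D_mon m m' : q2D (bD m) (bD m') = sgn K (degM m) *: gbr_mon K m m'.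
Proof. by rewrite /q2D /bilin !fglift1. Qed.

Lemma q2D0l y : q2D 0 y = 0.
Proof. exact: linear0. Qed.

Lemma q2D0r x : q2D x 0 = 0.
Proof.
rewrite /q2D /bilin (eq_fglift (g := fun=> 0)) ?fglift_0 // => m; exact: linear0.
Qed.

Lemma q2DZl c x y : q2D (c *: x) y = c *: q2D x y.
Proof. exact: linearZ. Qed.

Lemma q2DZr c x y : q2D x (c *: y) = c *: q2D x y.
Proof.
rewrite /q2D /bilin -fgliftZ; apply: eq_fglift => m; exact: linearZ.
Qed.

Lemma q2D_suml (I : Type) (s : seq I) (f : I -> D) y :
  q2D (\sum_(i <- s) f i) y = \sum_(i <- s) q2D (f i) y.
Proof. exact: linear_sum. Qed.

Lemma q2D_sumr (I : Type) (s : seq I) x (f : I -> D) :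
  q2D x (\sum_(i <- s) f i) = \sum_(i <- s) q2D x (f i).
Proof.
rewrite /q2D /bilin -fglift_sum; apply: eq_fglift => m; exact: linear_sum.
Qed.

Lemma dD_mon1 m : dD (bD m) = dD_mon K m.
Proof. exact: fglift1. Qed.

(** The tensor f(e2) (x) e1^n, which is the shape of every coefficient of the twist. *)
Definition polyE (f : {poly K}) n : D :=
  \sum_(j < size f) f`_j *: bD [:: (0, j : nat)%N; (n, 0)%N].

Lemma EV_polyE v f n : EV v (polyE f n) =
  if v is [:: w1; w2] then f.[w1.2] * w2.1 ^+ n else 0.
Proof.
rewrite linear_sum /=; under eq_bigr => j _ do rewrite linearZ /= EV1.
case: v => [|w1 [|w2 [|w3 v]]]; rewrite /= ?horner_coef ?mulr_suml.
- by rewrite big1 // => j _; rewrite scaler0.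
- by rewrite big1 // => j _; rewrite mulr0 scaler0.
- by apply: eq_bigr => j _; rewrite !expr0 mul1r !mulr1 -mulrA.
- by rewrite big1 // => j _; rewrite !mulr0 scaler0.
Qed.

Lemma EV_dD_polyE v f n : EV v (dD (polyE f n)) =
  if v is [:: w1; w2; w3] then
    f.[w1.2] * w2.1 ^+ n + f.[w1.2 + w2.2] * w3.1 ^+ n
    - f.[w1.2] * (w2.1 + w3.1) ^+ n - f.[w2.2] * w3.1 ^+ n else 0.
Proof.
rewrite /dD linear_sum linear_sum /=.
under eq_bigr => j _ do rewrite linearZ linearZ /= fglift1 EV_dD2.
case: v => [|w1 [|w2 [|w3 [|w4 v]]]]; try by rewrite big1 // => j _; rewrite scaler0.
rewrite !horner_coef !mulr_suml -big_split -!sumrB /=; apply: eq_bigr => j _.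
by rewrite !expr0 /GRing.scale /=; ring.
Qed.

Lemma EV_circ22 v i k j l :
  EV v (circ_mon K [:: (0, i)%N; (k, 0)%N] [:: (0, j)%N; (l, 0)%N]) =
  if v is [:: w1; w2; w3] then
    (w1.2 + w2.2 - (2 * l)%:R) ^+ i * w1.2 ^+ j * (w3.1 ^+ k * w2.1 ^+ l)
    - w1.2 ^+ i * w2.2 ^+ j * ((w2.1 + w3.1) ^+ k * w3.1 ^+ l)
  else 0.
Proof.
rewrite circ22 linearB /= !EV_umul !EV_delta_at.
case: v => [|w1 [|w2 [|w3 [|w4 v]]]]; rewrite /= ?muln0 ?subr0 ?expr0; try ring.
by rewrite addrA; ring.
Qed.

Lemma sum_horner2 (f g : {poly K}) a b c :
  \sum_(i < size f) \sum_(j < size g) f`_i * (g`_j * (a ^+ i * b ^+ j * c)) =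
  f.[a] * g.[b] * c.
Proof.
rewrite !horner_coef big_distrlr /= mulr_suml; apply: eq_bigr => i _.
by rewrite mulr_suml; apply: eq_bigr => j _; ring.
Qed.

(** The evaluated composition of A = f(e2) (x) e1^k with B = g(e2) (x) e1^l, that is (Delta (x)
    1)(A) (B (x) 1) - (1 (x) Delta)(A) (1 (x) B). Only the first product moves an e1 past an e2,
    hence the single shift by 2l. *)
Definition twist22 (f g : {poly K}) k l (w1 w2 w3 : K * K) : K :=
  f.[w1.2 + w2.2 - (2 * l)%:R] * w3.1 ^+ k * (g.[w1.2] * w2.1 ^+ l)
  - f.[w1.2] * (w2.1 + w3.1) ^+ k * (g.[w2.2] * w3.1 ^+ l).

Lemma EV_q2D_polyE v f g k l : EV v (q2D (polyE f k) (polyE g l)) =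
  if v is [:: w1; w2; w3] then - (twist22 f g k l w1 w2 w3 + twist22 g f l k w1 w2 w3) else 0.
Proof.
rewrite q2D_suml linear_sum /=.
transitivity (\sum_(i < size f) \sum_(j < size g) f`_i * (g`_j *
    (if v is [:: w1; w2; w3] then
      - ((w1.2 + w2.2 - (2 * l)%:R) ^+ i * w1.2 ^+ j * (w3.1 ^+ k * w2.1 ^+ l)
    - w1.2 ^+ i * w2.2 ^+ j * ((w2.1 + w3.1) ^+ k * w3.1 ^+ l)
     + (w1.2 ^+ i * (w1.2 + w2.2 - (2 * k)%:R) ^+ j * (w3.1 ^+ l * w2.1 ^+ k)
    - w2.2 ^+ i * w1.2 ^+ j * ((w2.1 + w3.1) ^+ l * w3.1 ^+ k))) else 0))).
  apply: eq_bigr => i _; rewrite q2DZl q2D_sumr linearZ linear_sum /= scaler_sumr.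
  apply: eq_bigr => j _; rewrite q2DZr linearZ /= q2D_mon /gbr_mon scaleN1r scaleN1r opprK.
  rewrite linearN linearD /= !EV_circ22; congr (_ * (_ * _)).
  by case: v => [|w1 [|w2 [|w3 [|w4 v]]]]; rewrite ?addr0 ?oppr0 //; ring.
case: v => [|w1 [|w2 [|w3 [|w4 v]]]];
  try by rewrite big1 // => i _; rewrite big1 // => j _; rewrite !mulr0.
rewrite -[RHS]mulN1r /twist22.
have E (f' g' : {poly K}) a b A B : f'.[a] * A * (g'.[b] * B) = f'.[a] * g'.[b] * (A * B) by ring.
rewrite !E [g.[w1.2 + _ - _] * _]mulrC [g.[w1.2] * f.[w2.2]]mulrC -!sum_horner2.
rewrite -!sumrB -big_split mulr_sumr /=; apply: eq_bigr => i _.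
by rewrite -!sumrB -big_split mulr_sumr /=; apply: eq_bigr => j _; ring.
Qed.

Lemma EV_q2D12 v i l p :
  EV v (q2D (bD [:: (0, i)%N; (l, 0)%N]) (bD [:: p])) =
  if v is [:: w1; w2] then
    ((w1.1 + w2.1) ^+ p.1 * (w1.2 + (w2.2 - (2 * l)%:R)) ^+ p.2 * w1.2 ^+ i * w2.1 ^+ l
     - (w1.2 - (2 * p.1)%:R) ^+ i * w2.1 ^+ l * (w1.1 ^+ p.1 * w1.2 ^+ p.2)
     - w1.2 ^+ i * w2.1 ^+ l * (w2.1 ^+ p.1 * w2.2 ^+ p.2))
  else 0.
Proof.
rewrite q2D_mon /gbr_mon scale1r scaleN1r opprB circ12 circ21 linearB linearD /=.
rewrite !EV_umul EV_delta_at !EV1.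
by case: v => [|w1 [|w2 [|w3 v]]]; rewrite /= ?muln0 ?subr0 ?expr0; ring.
Qed.

Lemma q2D21 i l p :
  q2D (bD [:: p]) (bD [:: (0, i)%N; (l, 0)%N]) = q2D (bD [:: (0, i)%N; (l, 0)%N]) (bD [:: p]).
Proof. by rewrite !q2D_mon /gbr_mon !scale1r scaleN1r opprB. Qed.

Lemma q2D_polyEC f l p : q2D (bD [:: p]) (polyE f l) = q2D (polyE f l) (bD [:: p]).
Proof.
rewrite q2D_suml q2D_sumr; apply: eq_bigr => i _.
by rewrite q2DZl q2DZr q2D21.
Qed.

Lemma EV_q2D_polyE1 v f l p :
  EV v (q2D (polyE f l) (bD [:: p])) =
  if v is [:: w1; w2] then
    ((w1.1 + w2.1) ^+ p.1 * (w1.2 + (w2.2 - (2 * l)%:R)) ^+ p.2 * (f.[w1.2] * w2.1 ^+ l)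
     - f.[w1.2 - (2 * p.1)%:R] * w2.1 ^+ l * (w1.1 ^+ p.1 * w1.2 ^+ p.2)
     - f.[w1.2] * w2.1 ^+ l * (w2.1 ^+ p.1 * w2.2 ^+ p.2))
  else 0.
Proof.
rewrite q2D_suml linear_sum /=.
under eq_bigr => i _ do rewrite q2DZl linearZ /= EV_q2D12.
case: v => [|w1 [|w2 [|w3 v]]]; try by rewrite big1 // => j _; rewrite scaler0.
rewrite !horner_coef !(mulr_suml, mulr_sumr) -!sumrB; apply: eq_bigr => i _.
by rewrite /GRing.scale /=; ring.
Qed.

Lemma EV_q2D11 v p q :
  EV v (q2D (bD [:: p]) (bD [:: q])) =
  if v is [:: w] then
    w.1 ^+ p.1 * (w.2 - (2 * q.1)%:R) ^+ p.2 * (w.1 ^+ q.1 * w.2 ^+ q.2)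
    - w.1 ^+ q.1 * (w.2 - (2 * p.1)%:R) ^+ q.2 * (w.1 ^+ p.1 * w.2 ^+ p.2)
  else 0.
Proof.
rewrite q2D_mon /gbr_mon !scale1r !circ11 linearB /= !EV_umul !EV1.
by case: v => [|w [|w' v]] /=; ring.
Qed.

Lemma q2D00 : q2D (bD [::]) (bD [::]) = 0.
Proof. by rewrite q2D_mon /gbr_mon circ_nil_l scaler0 subr0 scaler0. Qed.

Lemma q2D01 p : p != (0, 0)%N -> q2D (bD [::]) (bD [:: p]) = 0.
Proof.
by move=> /negPf nz; rewrite q2D_mon /gbr_mon circ_nil_l circ10 nz scale0r scaler0 subr0 scaler0.
Qed.

Lemma q2D10 p : p != (0, 0)%N -> q2D (bD [:: p]) (bD [::]) = 0.
Proof.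
by move=> /negPf nz; rewrite q2D_mon /gbr_mon circ_nil_l circ10 nz scale0r scaler0 subr0 scaler0.
Qed.

(** Composing with the unit of D^(-1) applies the counit to each factor, and the counit kills both
    f(e2) and e1^n: the twist is counital. *)
Lemma q2D_unit_polyE f n : f.[0] = 0 -> (0 < n)%N ->
  q2D (bD [::]) (polyE f n) = 0 /\ q2D (polyE f n) (bD [::]) = 0.
Proof.
move=> f0 n0; rewrite q2D_suml q2D_sumr !big1 //= => -[[|i] lti] _ /=;
  rewrite ?q2DZl ?q2DZr; try by rewrite -horner_coef0 f0 scale0r.
- by rewrite q2D_mon /gbr_mon circ_nil_l circ20 ?scaler0 ?subr0 ?scaler0 // xpair_eqE -(prednK n0).
- by rewrite q2D_mon /gbr_mon circ_nil_l circ20 ?scaler0 ?subr0 ?scaler0 // xpair_eqE -(prednK n0).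
Qed.

Lemma homogD0 k : homogD k (0 : D).
Proof. by move=> m; rewrite dom0. Qed.

Lemma homogD1 m : homogD (degM m) (bD m).
Proof. by move=> m'; rewrite domU1 inE => /eqP ->. Qed.

Lemma homogDZ k c x : homogD k x -> homogD k (c *: x).
Proof. by move=> hx m /domZ_subset; apply: hx. Qed.

Lemma homogDD k x y : homogD k x -> homogD k y -> homogD k (x + y).
Proof. by move=> hx hy m /domD_subset; rewrite mem_cat => /orP[/hx|/hy]. Qed.

Lemma homogDB k x y : homogD k x -> homogD k y -> homogD k (x - y).
Proof. by move=> hx hy; rewrite -scaleN1r; apply: homogDD => //; apply: homogDZ. Qed.

Lemma homogD_sum (I : Type) (s : seq I) (P : pred I) (f : I -> D) k :
  (forall i, P i -> homogD k (f i)) -> homogD k (\sum_(i <- s | P i) f i).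
Proof.
by move=> hf; apply: (big_ind (homogD k)) => //; [exact: homogD0 | exact: homogDD].
Qed.

Lemma homogD_polyE f n : homogD 1 (polyE f n).
Proof. by apply: homogD_sum => i _; apply/homogDZ/homogD1. Qed.

End Brackets.

(** * Signed sums over unshuffles, by recursion on the word *)

Section Unshuffles.
Variable K : fieldType.
Implicit Types (bs l r : seq EB) (b c : EB).

Definition sg2 b c : K := sgn K (sdegE b * sdegE c).
Definition sgl b l : K := \prod_(c <- l) sg2 b c.

Lemma sgn_sqr z : sgn K z * sgn K z = 1.
Proof. by rewrite /sgn; case: ifP => _; rewrite ?mulrNN mulr1. Qed.

Lemma sg2C b c : sg2 b c = sg2 c b.
Proof. by rewrite /sg2 mulrC. Qed.

Lemma sg2w b : sg2 Ew b = 1.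
Proof. by rewrite /sg2 /sdegE /= mul0r. Qed.

Lemma sgl_cons b c l : sgl b (c :: l) = sg2 b c * sgl b l.
Proof. exact: big_cons. Qed.

Lemma sgl_swap b l1 c d l2 : sgl b (l1 ++ c :: d :: l2) = sgl b (l1 ++ d :: c :: l2).
Proof. by rewrite /sgl !big_cat !big_cons /=; ring. Qed.

Lemma sgl_w l : sgl Ew l = 1.
Proof. by rewrite /sgl big1 // => c _; apply: sg2w. Qed.

Lemma sgl_nseqw b n : sgl b (nseq n Ew) = 1.
Proof. by elim: n => [|n IH]; rewrite /= ?/sgl ?big_nil // big_cons -/(sgl _ _) IH sg2C sg2w mulr1. Qed.

Variable M : lmodType K.
Implicit Types (G : seq EB -> seq EB -> M).

(* Sum over the unshuffles of [bs] with Koszul signs, by recursion on whether the head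
   goes to the first or to the second block. *)
Fixpoint unsh bs G : M :=
  if bs is b :: bs' then
    unsh bs' (fun l r => G (b :: l) r) + unsh bs' (fun l r => sgl b l *: G l (b :: r))
  else G [::] [::].

Lemma eq_unsh bs G G' : (forall l r, G l r = G' l r) -> unsh bs G = unsh bs G'.
Proof.
elim: bs G G' => [|b bs IH] G G' e /=; first exact: e.
by congr (_ + _); apply: IH => l r; rewrite e.
Qed.

Lemma unshD bs G G' : unsh bs (fun l r => G l r + G' l r) = unsh bs G + unsh bs G'.
Proof.
elim: bs G G' => [|b bs IH] G G' //=.
rewrite IH addrACA -IH; congr (_ + _); rewrite -IH; apply: eq_unsh => l r.
exact: scalerDr.
Qed.

Lemma unshZ bs k G : unsh bs (fun l r => k *: G l r) = k *: unsh bs G.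
Proof.
elim: bs G => [|b bs IH] G //=.
rewrite scalerDr -!IH; congr (_ + _); apply: eq_unsh => l r.
by rewrite !scalerA mulrC.
Qed.

Lemma unsh_eq0 (a : pred EB) bs G :
  (forall l r, (count a l + count a r = count a bs)%N -> G l r = 0) -> unsh bs G = 0.
Proof.
elim: bs G => [|b bs IH] G G0 /=; first exact: G0.
rewrite IH ?IH ?addr0 // => l r e; last by rewrite G0 //= -e; lia.
by rewrite G0 ?scaler0 //= -e; lia.
Qed.

Definition gsym G :=
  (forall l1 b c l2 r, G (l1 ++ b :: c :: l2) r = sg2 b c *: G (l1 ++ c :: b :: l2) r) /\
  (forall l r1 b c r2, G l (r1 ++ b :: c :: r2) = sg2 b c *: G l (r1 ++ c :: b :: r2)).

(** When b and c fall in the same block the symmetry of G gives the sign; when they are separated,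
    the two ways of separating them are exchanged and the sign comes from the Koszul factors. *)
Lemma unsh_swap s1 b c s2 G : gsym G ->
  unsh (s1 ++ b :: c :: s2) G = sg2 b c *: unsh (s1 ++ c :: b :: s2) G.
Proof.
elim: s1 G => [|a s1 IH] G [Gl Gr] /=.
  rewrite -!unshD -unshZ; apply: eq_unsh => l r.
  rewrite !sgl_cons !scalerDr !scalerA [sg2 c b]sg2C (Gl [::]) (Gr _ [::]) /= !mulrA sgn_sqr mul1r.
  rewrite -!addrA; congr (_ + _); rewrite addrCA; congr (_ + (_ + _)).
  by rewrite scalerA; congr (_ *: _); ring.
rewrite scalerDr -!IH //; split=> [l1 d e l2 r|l r1 d e r2].
- by rewrite sgl_swap Gl !scalerA mulrC.
- by rewrite (Gr l (a :: r1)) !scalerA mulrC.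
- exact: (Gl (a :: l1)).
- exact: Gr.
Qed.

Lemma unsh_nseqw n G :
  unsh (nseq n Ew) G = \sum_(k < n.+1) G (nseq k Ew) (nseq (n - k) Ew) *+ 'C(n, k).
Proof.
elim: n G => [|n IH] G; first by rewrite big_ord1.
rewrite [unsh _ _]/= !IH (sum_binS (fun k => G (nseq k Ew) (nseq (n.+1 - k) Ew))) addrC.
by congr (_ + _); apply: eq_bigr => k _; rewrite ?sgl_w ?scale1r ?subSS // subSn // -ltnS.
Qed.

Fixpoint kmask (m : bitseq) bs : K :=
  match m, bs with
  | t :: m', b :: bs' => (if t then 1 else sgl b (mask m' bs')) * kmask m' bs'
  | _, _ => 1
  end.

Definition consS n (t : bool) (S : {set 'I_n}) : {set 'I_n.+1} :=
  [set i | if unlift ord0 i is Some j then j \in S else t].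

Lemma consS0 n t (S : {set 'I_n}) : (ord0 \in consS t S) = t.
Proof. by rewrite inE unlift_none. Qed.

Lemma consSS n t (S : {set 'I_n}) j : (fintype.lift ord0 j \in consS t S) = (j \in S).
Proof. by rewrite inE liftK. Qed.

Lemma sum_consS n (H : {set 'I_n.+1} -> M) :
  \sum_S H S = \sum_S H (consS true S) + \sum_S H (consS false S).
Proof.
pose h (tS : bool * {set 'I_n}) := consS tS.1 tS.2.
rewrite (reindex h) /=; last first.
  exists (fun S : {set 'I_n.+1} => (ord0 \in S, [set j | fintype.lift ord0 j \in S])).
    move=> [t S] _; congr (_, _); first by rewrite consS0.
    by apply/setP => j; rewrite inE consSS.
  move=> S _; apply/setP => i; rewrite inE; case: unliftP => [j|] -> /=; by rewrite ?inE.
by rewrite -(pair_bigA _ (fun t S => H (consS t S))) /= big_bool.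
Qed.

Lemma inS_consS b bs t (S : {set 'I_(size bs)}) :
  @inS (b :: bs) (consS t S) = t :: inS S.
Proof.
rewrite /inS /= enum_ordSl /= consS0 -map_comp; congr (_ :: _).
by apply: eq_map => j /=; rewrite consSS.
Qed.

Lemma prod_mask (f : EB -> K) bs (S : {set 'I_(size bs)}) :
  \prod_(c <- mask (inS S) bs) f c = \prod_(j < size bs | j \in S) f (nth Eone bs j).
Proof.
elim: bs S => [|b bs IH] S; first by rewrite big_ord0 mask0 big_nil.
have -> : S = consS (ord0 \in S) [set j | fintype.lift ord0 j \in S].
  by apply/setP => i; rewrite inE; case: unliftP => [j|] -> /=; rewrite ?inE.
move: (ord0 \in S) [set j | _] => t S'.
rewrite inS_consS [RHS]big_mkcond big_ord_recl /= consS0.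
under [X in _ = _ * X]eq_bigr => j _ do rewrite consSS.
rewrite -big_mkcond -IH; case: t => /=; last by rewrite mul1r.
by rewrite big_cons.
Qed.

Lemma ksignE bs (S : {set 'I_(size bs)}) : ksign K S = kmask (inS S) bs.
Proof.
elim: bs S => [|b bs IH] S.
  rewrite /ksign big_ord0 /inS /=; by case: [seq _ | _ <- _].
have -> : S = consS (ord0 \in S) [set j | fintype.lift ord0 j \in S].
  by apply/setP => i; rewrite inE; case: unliftP => [j|] -> /=; rewrite ?inE.
move: (ord0 \in S) [set j | _] => t S'.
rewrite inS_consS /= -IH /ksign big_ord_recl; congr (_ * _).
  rewrite big_mkcond big_ord_recl /= mul1r consS0.
  case: t => /=; first by rewrite big1.
  rewrite /sgl prod_mask [RHS]big_mkcond; apply: eq_bigr => j _.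
  by rewrite consSS.
apply: eq_bigr => i _; rewrite big_mkcond big_ord_recl /= mul1r [RHS]big_mkcond.
by apply: eq_bigr => j _; rewrite !consSS /= /bump /= !add1n ltnS.
Qed.

Lemma unshE bs G :
  \sum_(S : {set 'I_(size bs)}) ksign K S *: G (blk1 S) (blk2 S) = unsh bs G.
Proof.
rewrite /blk1 /blk2; under eq_bigr => S _ do rewrite ksignE.
elim: bs G => [|b bs IH] G.
  rewrite (big_pred1 set0) /=; last first.
    by move=> S; apply/esym/eqP/setP => -[].
  by rewrite !mask0; case: (inS _) => [|? ?]; rewrite scale1r.
rewrite sum_consS /= -!IH; congr (_ + _); apply: eq_bigr => S _; rewrite inS_consS /=.
  by rewrite mul1r.
by rewrite scalerA mulrC.
Qed.

Lemma size_inS bs (S : {set 'I_(size bs)}) : size (inS S) = size bs.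
Proof. by rewrite size_map -cardE card_ord. Qed.

Lemma size_blk1 bs (S : {set 'I_(size bs)}) : size (blk1 S) = #|S|.
Proof.
rewrite /blk1 size_mask ?size_inS // /inS count_map cardE -size_filter.
by rewrite {2}/enum_mem enumT.
Qed.

Lemma size_blk2 bs (S : {set 'I_(size bs)}) : size (blk2 S) = (size bs - #|S|)%N.
Proof.
have sz : size (map negb (inS S)) = size bs by rewrite size_map size_inS.
rewrite /blk2 size_mask // count_map -size_blk1 /blk1 size_mask ?size_inS //.
by rewrite -(size_inS S) -(count_predC id (inS S)) addKn; apply: eq_count.
Qed.

End Unshuffles.

(** * Invariance under permutations from adjacent transpositions *)

Section AdjacentSwaps.
Variables (T : eqType) (P : seq T -> Prop).
Hypothesis P_swap : forall s1 b c s2, P (s1 ++ b :: c :: s2) -> P (s1 ++ c :: b :: s2).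

Lemma perm_swap_ind s t : perm_eq s t -> P s -> P t.
Proof.
have move1 pre b q post : P (pre ++ b :: q ++ post) -> P (pre ++ q ++ b :: post).
  elim: q pre => [|c q IH] pre //= /P_swap.
  by rewrite -cat_rcons => /IH; rewrite cat_rcons.
have block pre q1 q2 q3 : P (pre ++ q1 ++ q2 ++ q3) -> P (pre ++ q2 ++ q1 ++ q3).
  elim: q1 pre => [|b q1 IH] pre //=.
  by rewrite -cat_rcons => /IH; rewrite cat_rcons => /move1.
by apply: catCA_perm_ind => q1 q2 q3; apply: (block [::]).
Qed.

End AdjacentSwaps.

(** * The morphism given by the Jordanian twist and its structure equations *)

Section JordanianMorphism.
Variable K : fieldType.
Hypothesis charK0 : [pchar K] =i pred0.
Local Notation D := (DD K).
Local Notation bD := (bD K).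
Local Notation bE := (bE K).
Implicit Types (bs l r : seq EB) (b c : EB).

Lemma EB_cases b : [\/ b = Eone, b = Ee1, b = Ee2 | b = Ew].
Proof.
case: b => [[|[|[|[|n]]]] lt_n] //; [constructor 1|constructor 2|constructor 3|constructor 4];
  exact: val_inj.
Qed.

(** n! binom(X/2, n), so that [jord n] is n! times the coefficient of h^n in the twist. *)
Definition ffpoly n : {poly K} := \prod_(i < n) (2%:R^-1 *: 'X - (i%:R)%:P).

Lemma horner_ffpoly n y : (ffpoly n).[y] = ff (y / 2%:R) n.
Proof.
by rewrite horner_prod; apply: eq_bigr => i _; rewrite !hornerE mulrC.
Qed.

Definition jord n : D := polyE (ffpoly n) n.
Definition logterm n : D := logc K n *: bD [:: (n.+1, 0)%N].

(* The value on the basis elements [nw] different from [Ew], together with [n] copies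
   of [Ew]; there are no signs because it vanishes on two odd arguments. *)
Definition Fcomp (nw : seq EB) (n : nat) : D :=
  match nw with
  | [::] => if n is 0 then 0 else jord n
  | [:: b] => if b == Ee1 then logterm n
              else if n is 0 then (if b == Ee2 then bD [:: (0, 1)%N] else bD [::]) else 0
  | _ => 0
  end.

Definition nonw bs := [seq b <- bs | b != Ew].

Definition Fmor bs : D := Fcomp (nonw bs) (count_mem Ew bs).

Lemma Fmor_eq0 bs : (1 < count (predC1 Ew) bs)%N -> Fmor bs = 0.
Proof. by rewrite /Fmor -size_filter -/(nonw bs); case: (nonw bs) => [|b [|c s]]. Qed.

Lemma Fmor_perm bs bs' : perm_eq bs bs' -> Fmor bs = Fmor bs'.
Proof.
move=> e; have /permP ec := e; have ef := perm_filter (predC1 Ew) e.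
have [lt1|] := ltnP 1 (count (predC1 Ew) bs); first by rewrite !Fmor_eq0 // -ec.
rewrite -size_filter => le1; rewrite /Fmor /nonw.
by rewrite (perm_small_eq _ ef) ?ec // -(perm_size ef).
Qed.

Lemma Fmor_swap s1 b c s2 :
  Fmor (s1 ++ b :: c :: s2) = sg2 K b c *: Fmor (s1 ++ c :: b :: s2).
Proof.
have -> : Fmor (s1 ++ b :: c :: s2) = Fmor (s1 ++ c :: b :: s2).
  by apply: Fmor_perm; rewrite perm_cat2l; rewrite (perm_catCA [:: b] [:: c] s2).
have [->|nb] := eqVneq b Ew; first by rewrite sg2w scale1r.
have [->|nc] := eqVneq c Ew; first by rewrite sg2C sg2w scale1r.
by rewrite Fmor_eq0 ?scaler0 // count_cat /= nb nc; lia.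
Qed.

Lemma Fmor_nil : Fmor [::] = 0. Proof. by []. Qed.

Lemma nonw_nseqw n : nonw (nseq n Ew) = [::].
Proof. by rewrite /nonw; elim: n => [|n IH] //=. Qed.

Lemma Fmor_nseqw n : Fmor (nseq n Ew) = if n is 0 then 0 else jord n.
Proof. by rewrite /Fmor nonw_nseqw count_nseq /= mul1n. Qed.

Lemma Fmor_cons b n : b != Ew -> Fmor (b :: nseq n Ew) = Fcomp [:: b] n.
Proof.
by move=> nb; rewrite /Fmor /nonw /= nb -/(nonw _) nonw_nseqw count_nseq /= mul1n (negPf nb).
Qed.

Lemma homog_Fmor bs : homogD ((\sum_(b <- bs) sdegE b) + 1) (Fmor bs).
Proof.
have -> : \sum_(b <- bs) sdegE b = \sum_(b <- nonw bs) sdegE b.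
  rewrite /nonw big_filter [RHS]big_mkcond /=; apply: eq_bigr => b _.
  by case: eqP => [->|].
have := filter_all (predC1 Ew) bs; rewrite -/(nonw bs) /Fmor.
move: (nonw bs) (count_mem Ew bs) => [|b [|c s]] n //=; last by move=> _; apply: homogD0.
  by move=> _; rewrite big_nil; case: n => [|n]; [exact: homogD0 | exact: homogD_polyE].
rewrite big_seq1; case: (EB_cases b) => -> //= _.
- by case: n => [|n]; [exact: (@homogD1 K [::]) | exact: homogD0].
- by apply: homogDZ; exact: (@homogD1 K [:: _]).
- by case: n => [|n]; [exact: (@homogD1 K [:: _]) | exact: homogD0].
Qed.

(** Both quadratic terms are written as functions of two blocks, so that each side becomes a single
    [unsh] sum; the size test in [RG] selects the unshuffles with first block of size two. *)
Definition LG l r : D := q2D (Fmor l) (Fmor r).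
Definition RG l r : D :=
  if size l == 2%N then fglift (fun b => Fmor (b :: r)) (q2E K (nth Eone l 0) (nth Eone l 1))
  else 0.

Lemma q2E_sym b c : q2E K b c = sg2 K b c *: q2E K c b.
Proof.
case: (EB_cases b) => ->; case: (EB_cases c) => ->;
  rewrite /q2E /brE /sg2 /sgn /= ?scaler0 //;
  by rewrite ?scale1r ?scaleN1r ?scaleNr ?opprK.
Qed.

Lemma gsym_LG : gsym LG.
Proof.
split=> [l1 b c l2 r|l r1 b c r2]; rewrite /LG (Fmor_swap _ b c).
  exact: q2DZl.
exact: q2DZr.
Qed.

Lemma gsym_RG : gsym RG.
Proof.
split=> [l1 b c l2 r|l r1 b c r2]; rewrite /RG.
  case: l1 => [|d l1]; last first.
    by rewrite /= !size_cat /= !addnS !eqSS scaler0.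
  case: l2 => [|d l2] /=; last by rewrite scaler0.
  by rewrite q2E_sym linearZ.
case: ifP => _; last by rewrite scaler0.
rewrite -fgliftZ; apply: eq_fglift => d; exact: (Fmor_swap (d :: r1)).
Qed.

Definition Eqn bs := q1D (Fmor bs) + 2%:R^-1 *: unsh bs LG = unsh bs RG.

Lemma q1DZ k (x : D) : q1D (k *: x) = k *: q1D x.
Proof. by rewrite /q1D /dD linearZ scalerN. Qed.

Lemma q1D0 : q1D 0 = 0 :> D.
Proof. by rewrite /q1D /dD linear0 oppr0. Qed.

Lemma Eqn_swap s1 b c s2 : Eqn (s1 ++ b :: c :: s2) -> Eqn (s1 ++ c :: b :: s2).
Proof.
rewrite /Eqn (Fmor_swap _ c b) (unsh_swap _ c b _ gsym_LG) (unsh_swap _ c b _ gsym_RG) => <-.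
by rewrite q1DZ scalerDr !scalerA mulrC.
Qed.

Lemma q2E_u b : q2E K Eone b = 0.
Proof. by case: (EB_cases b) => ->; rewrite /q2E scaler0. Qed.

Lemma q2E_ww : q2E K Ew Ew = 0.
Proof. by rewrite /q2E scaler0. Qed.

(** The character by which b acts on the line spanned by e1 /\ e2, extended by 0 to the unit. *)
Definition kap b : K := if b == Ee2 then - 2%:R else 0.

Lemma q2E_w b : b != Ew -> q2E K b Ew = kap b *: bE Ew.
Proof.
by case: (EB_cases b) => -> // _; rewrite /q2E /kap /= ?scale0r ?scaler0 // scale1r.
Qed.

Lemma RG_w b r k : b != Ew ->
  RG (b :: nseq k Ew) r = if k == 1%N then kap b *: Fmor (Ew :: r) else 0.
Proof.
move=> nb; rewrite /RG /= size_nseq eqSS; case: eqP => [->|] //=.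
by rewrite q2E_w // linearZ /= fglift1.
Qed.

Lemma RG_nseqw k r : RG (nseq k Ew) r = 0.
Proof.
by rewrite /RG size_nseq; case: eqP => [->|] //=; rewrite q2E_ww linear0.
Qed.

Lemma half_sub (y : K) k : (y - (2 * k)%:R) / 2%:R = y / 2%:R - k%:R.
Proof. by rewrite mulrBl natrM mulrAC mulfV ?mul1r // (pcharf0P K).1. Qed.

Lemma Fmor_jord n : (0 < n)%N -> Fmor (nseq n Ew) = jord n.
Proof. by rewrite Fmor_nseqw; case: n. Qed.

Lemma Eqn_w n : Eqn (nseq n Ew).
Proof.
rewrite /Eqn !unsh_nseqw [RHS]big1 => [|k _]; last by rewrite RG_nseqw mul0rn.
case: n => [|n]; first by rewrite big_ord1 /LG q2D0l scaler0 addr0 Fmor_nil q1D0.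
set N := n.+1; rewrite Fmor_nseqw.
have inv2 : 2%:R^-1 * (1 + 1) = 1 :> K by rewrite -[1 + 1]/(2%:R) mulVf // (pcharf0P K).1.
apply: (EV_eq0 charK0) => v.
rewrite linearD linearN linearZ linear_sum /= EV_dD_polyE.
under eq_bigr => k _ do rewrite raddfMn /= /LG !Fmor_nseqw.
case: v => [|w1 [|w2 [|w3 [|w4 v]]]]; try by
  rewrite oppr0 add0r big1 ?scaler0 // => k _; case: (k : nat) => [|k'];
  rewrite ?q2D0l ?linear0 ?mul0rn //; case: (_ - _)%N => [|k'']; rewrite ?q2D0r ?linear0 ?mul0rn //;
  rewrite EV_q2D_polyE mul0rn.
pose phi k := twist22 (ffpoly (N - k)) (ffpoly k) (N - k) k w1 w2 w3.
(* The twist is J = 1 + R, but only R is a value of the morphism. So [psi] drops k = 0 and k = N,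
   the terms containing the summand 1 of J; these two make up the differential of [jord N]. *)
pose psi k := if (0 < k < N)%N then phi k else 0.
have phi0 : \sum_(k < N.+1) phi k *+ 'C(N, k) = 0.
  rewrite -[RHS](twist_identity (w1.2 / 2%:R) (w2.2 / 2%:R) w2.1 w3.1 N).
  apply: eq_bigr => k _; rewrite /phi /twist22 !horner_ffpoly; congr ((ff _ _ * _ * _ - _) *+ _).
  by rewrite half_sub mulrDl.
have psiN : psi N = 0 by rewrite /psi ltnn andbF.
have psi00 : psi 0%N = 0 by [].
have psi0 : \sum_(k < N.+1) psi k *+ 'C(N, k) = - (phi 0%N + phi N).
  apply/eqP; rewrite -addr_eq0 -[X in _ == X]phi0; apply/eqP.
  rewrite big_ord_recl big_ord_recr [RHS]big_ord_recl [X in _ = _ + X]big_ord_recr /=.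
  rewrite -[bump 0 n]/N psiN !mul0rn add0r addr0 bin0 binn !mulr1n addrCA; congr (_ + (_ + _)).
  by apply: eq_bigr => k _; rewrite /psi /bump /= add1n ltnS ltn_ord.
(* The bracket of two degree-1 elements contains both compositions; reversing k identifies their
   sums and cancels the factor 1/2. *)
have psi_rev : \sum_(k < N.+1) psi (N - k)%N *+ 'C(N, k) = - (phi 0%N + phi N).
  rewrite -psi0 [RHS](reindex_inj rev_ord_inj); apply: eq_bigr => k _ /=.
  by rewrite subSS bin_sub // -ltnS.
rewrite /GRing.scale /=.
transitivity (- (phi 0%N + phi N) + 2%:R^-1 * - (\sum_(k < N.+1) psi k *+ 'C(N, k) +
    \sum_(k < N.+1) psi (N - k)%N *+ 'C(N, k))).
  congr (- _ + _ * _).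
    rewrite /phi /twist22 subn0 subnn !horner_ffpoly !ff0 !expr0 muln0 subr0; ring.
  rewrite -big_split -sumrN; apply: eq_bigr => k _ /=; rewrite -mulrnDl -mulNrn; congr (_ *+ _).
  have := ltn_ord k; move: (nat_of_ord k) => {k} [|k] ltk.
    by rewrite q2D0l linear0 subn0 psi00 psiN addr0 oppr0.
  have [le_kn|lt_kn] := leqP N k.+1.
    have -> : k.+1 = N by apply/eqP; rewrite eqn_leq le_kn andbT.
    by rewrite subnn q2D0r linear0 psi00 psiN addr0 oppr0.
  have [j ej] : exists j, (N - k.+1 = j.+1)%N.
    by exists (N - k.+1).-1; rewrite prednK // subn_gt0.
  rewrite ej EV_q2D_polyE -ej /psi lt_kn /= /phi (subKn (ltnW lt_kn)).
  by rewrite ifT 1?addrC // ej /=; lia.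
rewrite psi0 psi_rev.
transitivity (- (phi 0%N + phi N) + 2%:R^-1 * (1 + 1) * (phi 0%N + phi N)); first ring.
by rewrite inv2 mul1r addNr.
Qed.

Lemma unsh_cons_w (M : lmodType K) b n (G : seq EB -> seq EB -> M) :
  unsh (b :: nseq n Ew) G =
  \sum_(k < n.+1) G (b :: nseq k Ew) (nseq (n - k) Ew) *+ 'C(n, k) +
  \sum_(k < n.+1) G (nseq k Ew) (b :: nseq (n - k) Ew) *+ 'C(n, k).
Proof.
by rewrite /= !unsh_nseqw; congr (_ + _); apply: eq_bigr => k _; rewrite sgl_nseqw scale1r.
Qed.

(** The factor 1/2 compensates for b lying in either block, which gives equal sums after k -> n -
    k. *)
Lemma unsh_cons_rev (M : lmodType K) b n (G : seq EB -> seq EB -> M) :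
  (forall k l : nat, G (nseq k Ew) (b :: nseq l Ew) = G (b :: nseq l Ew) (nseq k Ew)) ->
  2%:R^-1 *: unsh (b :: nseq n Ew) G =
  \sum_(k < n.+1) G (b :: nseq k Ew) (nseq (n - k) Ew) *+ 'C(n, k).
Proof.
move=> Gsym; rewrite unsh_cons_w; set s := (X in X + _).
have -> : \sum_(k < n.+1) G (nseq k Ew) (b :: nseq (n - k) Ew) *+ 'C(n, k) = s.
  rewrite (reindex_inj rev_ord_inj); apply: eq_bigr => k _ /=.
  by rewrite subSS Gsym bin_sub ?subKn // -ltnS.
by rewrite -mulr2n -scaler_nat scalerA mulVf ?scale1r // (pcharf0P K).1.
Qed.

Lemma Eqn_e1 n : Eqn (Ee1 :: nseq n Ew).
Proof.
rewrite /Eqn unsh_cons_rev; last first.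
  move=> k l; rewrite /LG Fmor_nseqw Fmor_cons //=; case: k => [|k]; first by rewrite q2D0l q2D0r.
  by rewrite /logterm q2DZl q2DZr q2D_polyEC.
rewrite [RHS]unsh_cons_w [X in _ = X + _]big1 => [|k _]; last first.
  by rewrite RG_w // /kap /= scale0r if_same mul0rn.
rewrite [X in _ = _ + X]big1 => [|k _]; last by rewrite RG_nseqw mul0rn.
rewrite addr0 big_ord_recr /= {2}/LG subnn Fmor_nil q2D0r mul0rn addr0.
apply: (EV_eq0 charK0) => v.
have termE (k : 'I_n) : EV v (LG (Ee1 :: nseq k Ew) (nseq (n - k) Ew)) =
    if v is [:: w1; w2] then logc K k * ((w1.1 + w2.1) ^+ k.+1 *
       (ff (w1.2 / 2%:R) (n - k) * w2.1 ^+ (n - k))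
     - ff (w1.2 / 2%:R - k.+1%:R) (n - k) * w2.1 ^+ (n - k) * w1.1 ^+ k.+1
     - ff (w1.2 / 2%:R) (n - k) * w2.1 ^+ (n - k) * w2.1 ^+ k.+1) else 0.
  rewrite /LG Fmor_cons //= Fmor_jord ?subn_gt0 // /logterm q2DZl linearZ /= q2D_polyEC EV_q2D_polyE1.
  case: v => [|w1 [|w2 [|w3 v]]] /=; rewrite ?scaler0 //.
  by rewrite !horner_ffpoly half_sub !expr0 !mulr1.
rewrite linearD linear_sum /= Fmor_cons //= q1DZ /q1D dD_mon1 linearZ linearN /= EV_dD1.
under eq_bigr => k _ do rewrite raddfMn /= termE.
case: v {termE} => [|w1 [|w2 [|w3 v]]];
  try by rewrite oppr0 scaler0 add0r big1 // => k _; rewrite mul0rn.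
have := log_identity charK0 (w1.2 / 2%:R) w1.1 w2.1 n.
(* The summand k = n pairs [logterm n] with the constant term 1 of the twist; it is the differential
   of [logterm n], up to the sign carried by [q1D]. *)
rewrite big_ord_recr /= => e; rewrite -[RHS]e addrC; congr (_ + _).
rewrite subnn !ff0 binn /GRing.scale /= !expr0; ring.
Qed.

Lemma dD_unit : dD (bD [::]) = 0.
Proof. by rewrite dD_mon1 /dD_mon big_ord0 subr0 scaleN1r subrr. Qed.

Lemma dD_e2 : dD (bD [:: (0, 1)%N]) = 0.
Proof.
apply: (EV_eq0 charK0) => v; rewrite dD_mon1 EV_dD1.
by case: v => [|w1 [|w2 [|w3 v]]] //=; rewrite !expr0 !expr1; ring.
Qed.

Lemma Eqn_e2 n : Eqn (Ee2 :: nseq n Ew).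
Proof.
rewrite /Eqn unsh_cons_rev; last first.
  move=> k l; rewrite /LG Fmor_nseqw Fmor_cons //=; case: k => [|k]; first by rewrite q2D0l q2D0r.
  by case: l => [|l]; rewrite ?q2D0l ?q2D0r // q2D_polyEC.
rewrite unsh_cons_w [X in _ = _ + X]big1 => [|k _]; last by rewrite RG_nseqw mul0rn.
rewrite addr0; under [RHS]eq_bigr => k _ do rewrite RG_w //.
case: n => [|n].
  by rewrite !big_ord1 /LG Fmor_nil q2D0r mul0rn addr0 Fmor_cons //= /q1D dD_e2 oppr0.
(* On the left only k = 0 survives, the bracket of e2 with [jord n.+1]. On the right only k = 1
   does, [e2, e1 /\ e2] = -2 e1 /\ e2 taken n + 1 times: the weight of e1^(n+1) under ad e2. *)
rewrite big_ord_recl [X in _ + (_ + X)]big1 => [|k _]; last first.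
  by rewrite /LG Fmor_cons //= q2D0l mul0rn.
rewrite !big_ord_recl [X in _ = _ + (_ + X)]big1 => [|k _]; last by rewrite mul0rn.
rewrite mul0rn add0r !addr0 Fmor_cons //= q1D0 add0r ?subn0 ?subn1 /= ?bin0 ?bin1 ?mulr1n.
rewrite /LG (Fmor_cons 0 (isT : Ee2 != Ew)) (Fmor_jord (ltn0Sn n : (0 < n.+1)%N)) /=.
rewrite /kap /=; apply: (EV_inj charK0) => v.
rewrite q2D_polyEC EV_q2D_polyE1 -[X in _ = EV v X]scaler_nat scalerA linearZ /= EV_polyE.
case: v => [|w1 [|w2 [|w3 v]]] //=; rewrite ?scaler0 //.
rewrite muln0 subr0 !expr0 !expr1 /GRing.scale /= natrM; ring.
Qed.

Lemma horner_ffpoly0 n : (0 < n)%N -> (ffpoly n).[0] = 0.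
Proof.
case: n => // n _; rewrite horner_ffpoly mul0r /ff big_ord_recl /= subr0; exact: mul0r.
Qed.

Lemma Eqn_u n : Eqn (Eone :: nseq n Ew).
Proof.
rewrite /Eqn !unsh_cons_w.
have LGu (k l : nat) : LG (Eone :: nseq k Ew) (nseq l Ew) = 0 /\ LG (nseq l Ew) (Eone :: nseq k Ew) = 0.
  rewrite /LG Fmor_nseqw Fmor_cons //=; case: l => [|l]; first by rewrite q2D0l q2D0r.
  case: k => [|k]; first by apply: q2D_unit_polyE => //; apply: horner_ffpoly0.
  by rewrite q2D0l q2D0r.
rewrite !big1 => [|k _|k _|k _|k _]; rewrite ?(LGu _ _).1 ?(LGu _ _).2 ?RG_nseqw ?mul0rn //.
  rewrite !addr0 scaler0 addr0 Fmor_cons //=.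
  by case: n {LGu} => [|n]; rewrite ?q1D0 // /q1D dD_unit oppr0.
by rewrite RG_w // /kap /= scale0r if_same mul0rn.
Qed.

Lemma unsh_cons2_w (M : lmodType K) b c n (G : seq EB -> seq EB -> M) :
  unsh (b :: c :: nseq n Ew) G =
  \sum_(k < n.+1) (G (b :: c :: nseq k Ew) (nseq (n - k) Ew)
    + G (b :: nseq k Ew) (c :: nseq (n - k) Ew)
    + sg2 K b c *: G (c :: nseq k Ew) (b :: nseq (n - k) Ew)
    + G (nseq k Ew) (b :: c :: nseq (n - k) Ew)) *+ 'C(n, k).
Proof.
rewrite /= !unsh_nseqw -!big_split; apply: eq_bigr => k _ /=.
by rewrite sgl_cons !sgl_nseqw !scale1r mulr1 -!mulrnDl addrA.
Qed.

Lemma Fmor_cons2 b c n : b != Ew -> c != Ew -> Fmor (b :: c :: nseq n Ew) = 0.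
Proof. by move=> nb nc; rewrite Fmor_eq0 //= nb nc. Qed.

Lemma RG_sum_w n b c : b != Ew -> c != Ew ->
  \sum_(k < n.+1) RG (b :: nseq k Ew) (c :: nseq (n - k) Ew) *+ 'C(n, k) =
  (kap b *: Fmor (c :: nseq n Ew)) *+ n.
Proof.
move=> nb nc; under eq_bigr => k _ do rewrite RG_w //.
case: n => [|n]; first by rewrite big_ord1 mul0rn.
rewrite !big_ord_recl big1 => [|k _]; last by rewrite mul0rn.
rewrite mul0rn add0r addr0 /= subn1 /= bin1.
by congr (_ *: _ *+ _); apply: Fmor_perm; rewrite (perm_catCA [:: Ew] [:: c] (nseq n Ew)).
Qed.

Lemma unsh_RG2 b c n : b != Ew -> c != Ew ->
  unsh (b :: c :: nseq n Ew) RG =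
  fglift (fun d => Fmor (d :: nseq n Ew)) (q2E K b c)
  + (kap b *: Fmor (c :: nseq n Ew)) *+ n
  + sg2 K b c *: (kap c *: Fmor (b :: nseq n Ew)) *+ n.
Proof.
move=> nb nc; rewrite unsh_cons2_w; under eq_bigr => k _ do rewrite RG_nseqw addr0 !mulrnDl.
rewrite !big_split /= RG_sum_w //; congr (_ + _ + _).
  rewrite big_ord_recl big1 => [|k _]; last by rewrite /RG /= mul0rn.
  by rewrite /RG /= subn0 bin0 mulr1n addr0.
rewrite scalerMnr -(RG_sum_w _ nc nb) scaler_sumr; apply: eq_bigr => k _.
by rewrite scalerMnr.
Qed.

Lemma unsh_LG2 b c n : b != Ew -> c != Ew ->
  unsh (b :: c :: nseq n Ew) LG =
  \sum_(k < n.+1) (q2D (Fcomp [:: b] k) (Fcomp [:: c] (n - k))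
    + sg2 K b c *: q2D (Fcomp [:: c] k) (Fcomp [:: b] (n - k))) *+ 'C(n, k).
Proof.
move=> nb nc; rewrite unsh_cons2_w; apply: eq_bigr => k _; congr (_ *+ _).
by rewrite /LG !Fmor_cons2 // !Fmor_cons // q2D0l q2D0r add0r addr0.
Qed.

Lemma Eqn2_vanish b c n : b != Ew -> c != Ew ->
  (forall k l : nat, q2D (Fcomp [:: b] k) (Fcomp [:: c] l) = 0 /\
               q2D (Fcomp [:: c] k) (Fcomp [:: b] l) = 0) ->
  q2E K b c = 0 ->
  (kap b *: Fcomp [:: c] n) *+ n = 0 -> (kap c *: Fcomp [:: b] n) *+ n = 0 ->
  Eqn (b :: c :: nseq n Ew).
Proof.
move=> nb nc v0 q0 kb kc; rewrite /Eqn unsh_LG2 // unsh_RG2 // q0 linear0 add0r Fmor_cons2 // q1D0.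
rewrite big1 => [|k _]; last by rewrite !(v0 _ _).1 !(v0 _ _).2 scaler0 addr0 mul0rn.
by rewrite !Fmor_cons // kb scalerMnr kc !scaler0 addr0.
Qed.

Lemma Eqn_e1e2 n : Eqn (Ee1 :: Ee2 :: nseq n Ew).
Proof.
rewrite /Eqn unsh_LG2 // unsh_RG2 // Fmor_cons2 // q1D0 add0r !Fmor_cons //.
have -> : q2E K Ee1 Ee2 = 2%:R *: bE Ee1 by rewrite /q2E scale1r.
rewrite linearZ /= fglift1 Fmor_cons //= /kap /= scale0r mul0rn addr0.
have -> : sg2 K Ee1 Ee2 = -1 by [].
(* All copies of e1 /\ e2 must join e1, since the component with e2 vanishes otherwise. What remains
   is [e1^(n+1), e2] = 2(n+1) e1^(n+1). *)
have -> : \sum_(k < n.+1)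
    (q2D (logterm k) match (n - k)%N with 0%N => bD [:: (0, 1)%N] | _.+1 => 0 end
     + -1 *: q2D match (k : nat) with 0%N => bD [:: (0, 1)%N] | _.+1 => 0 end (logterm (n - k)))
      *+ 'C(n, k)
   = q2D (logterm n) (bD [:: (0, 1)%N]) - q2D (bD [:: (0, 1)%N]) (logterm n).
  under eq_bigr => k _ do rewrite mulrnDl.
  rewrite big_split /=; congr (_ + _).
    rewrite big_ord_recr /= subnn binn mulr1n big1 ?add0r // => k _.
    by rewrite -(prednK (_ : 0 < n - k)%N) ?subn_gt0 //= q2D0r mul0rn.
  rewrite big_ord_recl big1 => [|k _]; last by rewrite q2D0l scaler0 mul0rn.
  by rewrite addr0 scaleN1r subn0 bin0 mulr1n.
apply: (EV_inj charK0) => v.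
rewrite /logterm q2DZl q2DZr -scalerBr -[X in _ = EV v (_ + X)]scaler_nat !scalerA -scalerDl.
rewrite !linearZ /= linearB /= !EV_q2D11 EV1.
case: v => [|w [|w' v]] //=; rewrite ?mulr0 ?subr0 ?scaler0 ?mul0rn ?addr0 //.
rewrite !expr0 !expr1 /GRing.scale /= natrM.
have nz2 : 2%:R != 0 :> K by rewrite (pcharf0P K).1.
by field.
Qed.

Lemma Eqn2 b c n : b != Ew -> c != Ew -> Eqn (b :: c :: nseq n Ew).
Proof.
have k0 b' x : b' != Ee2 -> (kap b' *: (x : D)) *+ n = 0.
  by rewrite /kap => /negPf ->; rewrite scale0r mul0rn.
(* For n = 0 the multiplicity vanishes, for n > 0 the component does. *)
have kn b' : b' != Ee1 -> (kap Ee2 *: Fcomp [:: b'] n) *+ n = 0.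
  by move=> /= /negPf ->; case: n {k0} => [|?]; rewrite ?mulr0n // scaler0 mul0rn.
have ue1 : Eqn (Eone :: Ee1 :: nseq n Ew).
  apply: Eqn2_vanish; [by [] | by [] | move=> k l | exact: q2E_u | exact: k0 | exact: k0].
  split; rewrite /= /logterm ?q2DZl ?q2DZr.
    by case: k => [|?]; rewrite ?q2D0l ?q2D01 // scaler0.
  by case: l => [|?]; rewrite ?q2D0r ?q2D10 // scaler0.
have ue2 : Eqn (Eone :: Ee2 :: nseq n Ew).
  apply: Eqn2_vanish; [by [] | by [] | move=> k l | exact: q2E_u | exact: k0 | exact: kn].
  by split; case: k => [|?]; case: l => [|?] /=; rewrite ?q2D0l ?q2D0r ?q2D01 ?q2D10.
(case: (EB_cases b) => -> nb; last by move: nb; rewrite eqxx);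
  (case: (EB_cases c) => -> nc; last by move: nc; rewrite eqxx).
- apply: Eqn2_vanish; [by [] | by [] | move=> k l | exact: q2E_u | exact: k0 | exact: k0].
  by split; case: k => [|?]; case: l => [|?] /=; rewrite ?q2D0l ?q2D0r ?q2D00.
- exact: ue1.
- exact: ue2.
- exact: (@Eqn_swap [::] _ _ _ ue1).
- apply: Eqn2_vanish; [by [] | by [] | move=> k l | by rewrite /q2E scaler0 | exact: k0 | exact: k0].
  have aa (k' l' : nat) : q2D (logterm k') (logterm l') = 0.
    rewrite /logterm q2DZl q2DZr; suff -> : q2D (bD [:: (k'.+1, 0)%N]) (bD [:: (l'.+1, 0)%N]) = 0.
      by rewrite !scaler0.
    apply: (EV_eq0 charK0) => v; rewrite EV_q2D11.
    by case: v => [|w [|w' v]] //=; rewrite !expr0; ring.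
  by rewrite /= !aa.
- exact: Eqn_e1e2.
- exact: (@Eqn_swap [::] _ _ _ ue2).
- exact: (@Eqn_swap [::] _ _ _ (Eqn_e1e2 n)).
- apply: Eqn2_vanish; [by [] | by [] | move=> k l | by rewrite /q2E scaler0 | exact: kn | exact: kn].
  have ee : q2D (bD [:: (0, 1)%N]) (bD [:: (0, 1)%N]) = 0.
    by apply: (EV_eq0 charK0) => v; rewrite EV_q2D11; case: v => [|w [|w' v]] //=; ring.
  by case: k => [|?]; case: l => [|?] /=; rewrite ?q2D0l ?q2D0r ?ee.
Qed.

(** Of two blocks sharing three elements other than e1 /\ e2, one contains two of them. On the
    source side the bracket of two such elements is a multiple of e1, again not a multiple of e1 /\
    e2, so two of them always remain. *)
Lemma Eqn3 bs : (2 < count (predC1 Ew) bs)%N -> Eqn bs.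
Proof.
move=> gt2; rewrite /Eqn Fmor_eq0 1?ltnW // q1D0 add0r.
rewrite !(@unsh_eq0 _ _ (predC1 Ew)) ?scaler0 // => l r e.
  rewrite /RG; case: l e => [|b [|c [|d l]]] //= e.
  have [gt1|] := ltnP 1 (count (predC1 Ew) r).
    rewrite (eq_fglift (g := fun=> 0)) ?fglift_0 // => d.
    by rewrite Fmor_eq0 //=; apply: leq_trans gt1 _; rewrite leq_addl.
  move=> le1; have [nb nc r1] : [/\ b != Ew, c != Ew & (0 < count (predC1 Ew) r)%N].
    move: gt2 le1; rewrite -e; move: (count _ r) => x.
    by case: (b != Ew); case: (c != Ew) => /= gt2 le1; split=> //; exfalso; lia.
  have [k ->] : exists k, q2E K b c = k *: bE Ee1.
    case: (EB_cases b) nb => ->; case: (EB_cases c) nc => -> // _ _;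
    by [exists 0; rewrite /q2E scale0r scaler0 | eexists; rewrite /q2E scalerA].
  by rewrite linearZ /= fglift1 Fmor_eq0 ?scaler0 //=; lia.
rewrite /LG; have [gt1|le1] := ltnP 1 (count (predC1 Ew) l).
  by rewrite Fmor_eq0 // q2D0l.
rewrite [Fmor r]Fmor_eq0 ?q2D0r //; move: gt2 le1; rewrite -e.
by move: (count _ l) (count _ r) => x y; lia.
Qed.

Lemma Eqn_all bs : Eqn bs.
Proof.
have e : perm_eq (nonw bs ++ nseq (count_mem Ew bs) Ew) bs.
  rewrite -(permPr (permEl (perm_filterC (predC1 Ew) bs))) /nonw perm_cat2l.
  have /all_pred1P : all (pred1 Ew) [seq b <- bs | predC (predC1 Ew) b].
    by apply/allP => b; rewrite mem_filter /= negbK => /andP[].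
  move=> ->; rewrite size_filter (eq_count (a2 := pred1 Ew)) // => b /=.
  by rewrite negbK.
apply: (perm_swap_ind Eqn_swap e); have := filter_all (predC1 Ew) bs; rewrite -/(nonw bs).
move: (nonw bs) (count_mem Ew bs) => [|b [|c [|d s]]] n /=.
- by move=> _; apply: Eqn_w.
- rewrite andbT; case: (EB_cases b) => -> // _; [exact: Eqn_u | exact: Eqn_e1 | exact: Eqn_e2].
- by case/and3P => nb nc _; apply: Eqn2.
- by case/and4P => nb nc nd _; apply: Eqn3; rewrite /= nb nc nd.
Qed.

Lemma mlext_bE r (G : seq EB -> D) : mlext (map bE r) G = G r.
Proof. by elim: r G => [|b r IH] G //=; rewrite fglift1 IH. Qed.

Lemma Linf_Fmor : Linf_morphism Fmor.
Proof.
split=> [bs _|]; first exact: homog_Fmor.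
split=> [bs i lti|bs _].
  have ebs : take i bs ++ nth Eone bs i :: nth Eone bs i.+1 :: drop i.+2 bs = bs.
    by rewrite -!drop_nth ?cat_take_drop // ltnW.
  by rewrite /swap_at /= Fmor_swap ebs /sg2 mulrC.
(* The empty and the full first block may be added because the morphism is 0 on the empty word. *)
have -> : \sum_(S : {set 'I_(size bs)} | (0 < #|S| < size bs)%N)
     ksign K S *: q2D (Fmor (blk1 S)) (Fmor (blk2 S)) = unsh bs LG.
  rewrite -unshE big_mkcond; apply: eq_bigr => S _; rewrite /LG -(size_blk1 S).
  case: (posnP (size (blk1 S))) => [/size0nil ->|_]; first by rewrite q2D0l scaler0.
  case: ltnP => //= le_S; have /eqP/size0nil -> : size (blk2 S) == 0%N.
    by rewrite size_blk2 subn_eq0 -size_blk1.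
  by rewrite q2D0r scaler0.
rewrite Eqn_all -unshE [RHS]big_mkcond; apply: eq_bigr => S _.
rewrite /RG size_blk1; case: ifP => _; last by rewrite scaler0.
congr (_ *: _) => /=; apply: eq_fglift => b; exact/esym/mlext_bE.
Qed.

End JordanianMorphism.

(** * The cobar complex, its acyclic companion and polynomial calculus in the first factor *)

Section CobarCohomology.
Variable K : fieldType.
Hypothesis charK0 : [pchar K] =i pred0.
Local Notation D := (DD K).
Local Notation bD := (bD K).
Local Notation one := (0, 0)%N.
Implicit Types (v : seq (K * K)) (w : K * K) (m : Mon) (p q : nat * nat) (x y z : D).

Definition cns p : D -> D := fglift (fun m => bD (p :: m)).
HB.instance Definition _ p := GRing.Linear.copy (cns p) (fglift (fun m => bD (p :: m))).

Lemma cns1 p m : cns p (bD m) = bD (p :: m).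
Proof. exact: fglift1. Qed.

Definition Dl p m : D :=
  \sum_(i < p.1.+1) \sum_(j < p.2.+1) ('C(p.1, i) * 'C(p.2, j))%:R *:
     bD ((i : nat, j : nat) :: (p.1 - i, p.2 - j)%N :: m).

Lemma delta_at_mon0 p m : delta_at_mon K 0 (p :: m) = Dl p m.
Proof. by rewrite /delta_at_mon /= drop0. Qed.

Definition dbar p m : D := bD (one :: p :: m) + bD (p :: one :: m) - Dl p m.

(* The cobar differential is the graded derivation extending [dbar]; up to the
   global sign (-1)^k it is the differential of the DGLA. *)
Fixpoint dKm m : D := if m is p :: m' then dbar p m' - cns p (dKm m') else 0.
Definition dK : D -> D := fglift dKm.
HB.instance Definition _ := GRing.Linear.copy dK (fglift dKm).

Lemma dK1 m : dK (bD m) = dKm m.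
Proof. exact: fglift1. Qed.

Lemma dKmE m :
  dKm m = bD (one :: m) - \sum_(l < size m) (-1) ^+ l *: delta_at_mon K l m
          - (-1) ^+ size m *: bD (m ++ [:: one]).
Proof.
elim: m => [|p m IH] /=; first by rewrite big_ord0 scale1r subr0 subrr.
rewrite IH !linearB linear_sum linearZ /= !cns1 big_ord_recl scale1r delta_at_mon0 exprS mulN1r scaleNr.
rewrite /dbar; have -> : \sum_(i < size m) (-1) ^+ bump 0 i *: delta_at_mon K (bump 0 i) (p :: m)
   = - \sum_(i < size m) cns p ((-1) ^+ i *: delta_at_mon K i m).
  rewrite -sumrN; apply: eq_bigr => i _.
  rewrite /bump /= add1n delta_at_monS exprS mulN1r scaleNr.
  by rewrite [cns p _]linearZ.
rewrite !opprK opprB [bD _ + _ - _]addrAC -!addrA addNKr; congr (_ + _); exact: addrCA.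
Qed.

Lemma sgn_nat n : sgn K n%:Z = (-1) ^+ n.
Proof. by rewrite /sgn /= -signr_odd; case: (odd n). Qed.

Lemma dD_monE m : dD_mon K m = sgn K (degM m) *: dKm m.
Proof.
case: m => [|p m]; first by rewrite /dD_mon big_ord0 subr0 scaleN1r subrr scaler0.
have degE : degM (p :: m) = (size m)%:Z by rewrite /degM /= -addn1 PoszD addrK.
rewrite dKmE /dD_mon degE sgn_nat [size (p :: m)]/= !scalerBr scalerA.
rewrite exprS mulN1r mulrN -exprD addnn -mul2n mulnC exprM sqrr_sign scaleN1r opprK.
suff -> : \sum_(l < (size m).+1) sgn K ((size m)%:Z - l%:Z) *: delta_at l (bD (p :: m)) =
    (-1) ^+ size m *: \sum_(l < (size m).+1) (-1) ^+ l *: delta_at_mon K l (p :: m).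
  by rewrite addrC -[RHS]addrA [- _ + bD _]addrC.
rewrite scaler_sumr; apply: eq_bigr => l _; rewrite /delta_at fglift1 scalerA; congr (_ *: _).
have le_l : (l <= size m)%N by rewrite -ltnS.
have -> : (-1) ^+ size m = (-1) ^+ (size m - l) * (-1) ^+ l :> K by rewrite -exprD subnK.
by rewrite subzn // sgn_nat -mulrA -exprD addnn -mul2n exprM sqrrN !expr1n mulr1.
Qed.

Lemma EV_cns w v p y : EV (w :: v) (cns p y) = w.1 ^+ p.1 * w.2 ^+ p.2 * EV v y.
Proof.
rewrite /cns EV_fglift -[RHS]/(_ *: EV v y) -fgliftZ; apply: eq_fglift => m; exact: EV1.
Qed.

Lemma EV_cns_nil p y : EV [::] (cns p y) = 0.
Proof.
rewrite /cns EV_fglift (eq_fglift (g := fun=> 0 : K^o)) ?fglift_0 // => m; exact: EV1.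
Qed.

Definition mono p w : K := w.1 ^+ p.1 * w.2 ^+ p.2.

Lemma EV_dbar v p m : EV v (dbar p m) =
  if v is w1 :: w2 :: v' then (mono p w1 + mono p w2 - mono p (addp w1 w2)) * evm v' m else 0.
Proof.
rewrite /dbar linearB linearD /= -delta_at_mon0 EV_delta_at_mon !EV1.
by case: v => [|w1 [|w2 v]] /=; rewrite ?expr0 /mono /=; ring.
Qed.

Definition dhead x : D := fglift (fun m => if m is q :: m' then dbar q m' else 0) x.
Definition dsecond x : D :=
  fglift (fun m => if m is q :: q' :: m' then cns q (dbar q' m') else 0) x.

Lemma EV_dhead v x : EV v (dhead x) =
  if v is w1 :: w2 :: v' then EV (w1 :: v') x + EV (w2 :: v') x - EV (addp w1 w2 :: v') x else 0.
Proof.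
rewrite /dhead EV_fglift; case: v => [|w1 [|w2 v]].
- rewrite (eq_fglift (g := fun=> 0 : K^o)) ?fglift_0 // => -[|q m]; [exact: linear0 | exact: EV_dbar].
- rewrite (eq_fglift (g := fun=> 0 : K^o)) ?fglift_0 // => -[|q m]; [exact: linear0 | exact: EV_dbar].
rewrite /EV -fgliftD -fgliftB; apply: eq_fglift => -[|q m].
  by rewrite linear0 /= addr0 subr0.
by rewrite -/(EV _ _) EV_dbar /mono /=; ring.
Qed.

Lemma EV_dsecond v x : EV v (dsecond x) =
  if v is w1 :: w2 :: w3 :: v' then
    EV (w1 :: w2 :: v') x + EV (w1 :: w3 :: v') x - EV (w1 :: addp w2 w3 :: v') x else 0.
Proof.
rewrite /dsecond EV_fglift; case: v => [|w1 [|w2 [|w3 v]]].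
- rewrite (eq_fglift (g := fun=> 0 : K^o)) ?fglift_0 // => -[|q [|q' m]]; rewrite ?linear0 //.
  exact: EV_cns_nil.
- rewrite (eq_fglift (g := fun=> 0 : K^o)) ?fglift_0 // => -[|q [|q' m]]; rewrite ?linear0 //.
  by rewrite EV_cns EV_dbar mulr0.
- rewrite (eq_fglift (g := fun=> 0 : K^o)) ?fglift_0 // => -[|q [|q' m]]; rewrite ?linear0 //.
  by rewrite EV_cns EV_dbar mulr0.
rewrite /EV -fgliftD -fgliftB; apply: eq_fglift => -[|q [|q' m]].
- by rewrite linear0 /= addr0 subr0.
- by rewrite linear0 /= mulr0 addr0 subr0.
by rewrite -/(EV _ _) EV_cns EV_dbar /mono /=; ring.
Qed.

Lemma addpA w1 w2 w3 : addp w1 (addp w2 w3) = addp (addp w1 w2) w3.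
Proof. by rewrite /addp /= !addrA. Qed.

Lemma dbar_coassoc p m : dhead (dbar p m) = dsecond (dbar p m).
Proof.
apply: (EV_inj charK0) => v; rewrite EV_dhead EV_dsecond.
case: v => [|w1 [|w2 [|w3 v]]] //; rewrite !EV_dbar /= ?addr0 ?subrr //.
by rewrite addpA; ring.
Qed.

Lemma dK_cns p y : dK (cns p y) = fglift (fun m => dbar p m) y - cns p (dK y).
Proof.
transitivity (fglift (fun m => dKm (p :: m)) y).
  by rewrite {1}/cns linear_fglift; apply: eq_fglift => m /=; rewrite dK1.
by rewrite /= fgliftB; congr (_ - _); rewrite /dK linear_fglift; apply: eq_fglift.
Qed.

Lemma dbar_ext (f g : {linear D -> D}) p m :
  (forall q q', f (bD (q :: q' :: m)) = g (bD (q :: q' :: m))) -> f (dbar p m) = g (dbar p m).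
Proof.
move=> fg; suff e : f (Dl p m) = g (Dl p m) by rewrite /dbar !linearB !linearD /= !fg e.
rewrite /Dl !linear_sum; apply: eq_bigr => i _; rewrite !linear_sum; apply: eq_bigr => j _.
by rewrite !linearZ /= fg.
Qed.

Lemma dK_dK x : dK (dK x) = 0.
Proof.
rewrite {2}/dK linear_fglift -[RHS](fglift_0 D x); apply: eq_fglift => m /=.
elim: m => [|p m IH] /=; first exact: linear0.
rewrite linearB /= dK_cns IH linear0 subr0; apply/eqP; rewrite subr_eq0; apply/eqP.
(* The differential of q :: q' :: m splits into its action on q, on q' and on m. The first two
   cancel on [dbar p m] by coassociativity; the third yields [dbar p] with the tail [dKm m]. *)
pose hd (m' : Mon) : D := if m' is q :: m'' then dbar q m'' else 0.
pose sd (m' : Mon) : D := if m' is q :: q' :: m'' then cns q (dbar q' m'') else 0.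
pose tl (m' : Mon) : D := if m' is q :: q' :: _ then cns q (cns q' (dKm m)) else 0.
rewrite (dbar_ext (g := fglift (fun m' => hd m' - sd m' + tl m'))) => [|q q'] /=; last first.
  by rewrite dK1 fglift1 /= linearB /= opprB addrCA addrC.
rewrite fgliftD fgliftB -/(dhead _) -/(dsecond _) dbar_coassoc subrr add0r.
have cc q q' y : cns q (cns q' y) = fglift (fun m' => bD (q :: q' :: m')) y.
  by rewrite {2}/cns linear_fglift; apply: eq_fglift => m' /=; rewrite cns1.
rewrite /dbar /Dl fgliftB fgliftD !(linearB, linearD) /= !fglift1 /= !cc; congr (_ - _).
rewrite fglift_sum linear_sum; apply: eq_bigr => i _.
rewrite fglift_sum linear_sum; apply: eq_bigr => j _.
by rewrite linearZ fgliftZ /= fglift1 /= cc.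
Qed.

(** The cobar complex with coefficients in the coalgebra itself: the first entry is now a
    coefficient, and the empty list is the augmentation. The complex is acyclic, and the lists
    beginning with [one] form a shifted copy of the cobar complex inside it. *)
Definition dCm m : D := bD (one :: m) - dKm m.
Definition dC : D -> D := fglift dCm.
HB.instance Definition _ := GRing.Linear.copy dC (fglift dCm).

Lemma dC1 m : dC (bD m) = dCm m.
Proof. exact: fglift1. Qed.

Lemma dCE x : dC x = cns one x - dK x.
Proof. exact: fgliftB. Qed.

Lemma Dl_one m : Dl one m = bD (one :: one :: m).
Proof. by rewrite /Dl !big_ord1 scale1r. Qed.

Lemma dK_cns_one x : dK (cns one x) = cns one (cns one x) - cns one (dK x).
Proof.
rewrite dK_cns; congr (_ - _); rewrite {2}/cns linear_fglift; apply: eq_fglift => m /=.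
by rewrite /dbar Dl_one addrK cns1.
Qed.

Lemma dC_cns_one x : dC (cns one x) = cns one (dK x).
Proof. by rewrite dCE dK_cns_one subKr. Qed.

Lemma dC_dC x : dC (dC x) = 0.
Proof. by rewrite (dCE x) linearB /= dC_cns_one (dCE (dK x)) dK_dK subr0 subrr. Qed.

Lemma dCm_cons p m : dCm (p :: m) = Dl p m - bD (p :: one :: m) + cns p (dKm m).
Proof.
by rewrite /dCm /= /dbar !opprB opprD addrCA [bD _ + (_ + _)]addrCA addNKr addrC.
Qed.

(** Operators on the first factor only. They vanish on the empty list, which explains the conditions
    on [coeff [::]] in the inversion formulas. *)
Definition hopm (f : nat * nat -> K) (h : nat * nat -> nat * nat) m : D :=
  if m is p :: m' then f p *: bD (h p :: m') else 0.
Definition hop f h : D -> D := fglift (hopm f h).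
HB.instance Definition _ f h := GRing.Linear.copy (hop f h) (fglift (hopm f h)).

Lemma hop1 f h p m : hop f h (bD (p :: m)) = f p *: bD (h p :: m).
Proof. exact: fglift1. Qed.

Lemma hop_cns f h p y : hop f h (cns p y) = f p *: cns (h p) y.
Proof.
by rewrite {1}/cns linear_fglift -fgliftZ; apply: eq_fglift => m /=; rewrite hop1.
Qed.

Lemma hop_hop f h f' h' x :
  hop f h (hop f' h' x) = hop (fun p => f' p * f (h' p)) (fun p => h (h' p)) x.
Proof.
rewrite {2}/hop linear_fglift; apply: eq_fglift => -[|p m] /=; first exact: linear0.
by rewrite linearZ /= hop1 scalerA.
Qed.

(** Exponent maps are compared only where the coefficient is nonzero, because [p.1.-1] is
    meaningless at 0. *)
Lemma eq_hop f h f' h' x :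
  (forall p, f p = f' p) -> (forall p, f p != 0 -> h p = h' p) -> hop f h x = hop f' h' x.
Proof.
move=> ef eh; apply: eq_fglift => -[|p m] //=; rewrite -ef.
by have [->|/eh ->] := eqVneq (f p) 0; rewrite ?scale0r.
Qed.

Lemma hop0 h x : hop (fun=> 0) h x = 0.
Proof.
rewrite -[RHS](fglift_0 D x); apply: eq_fglift => -[|p m] //=; exact: scale0r.
Qed.

Lemma hopD f f' h x : hop f h x + hop f' h x = hop (fun p => f p + f' p) h x.
Proof.
rewrite -fgliftD; apply: eq_fglift => -[|p m] /=; by rewrite ?addr0 // scalerDl.
Qed.

Lemma hop_id x : coeff [::] x = 0 -> hop (fun=> 1) id x = x.
Proof.
move=> x0; rewrite -[RHS]fglift_id; apply: eq_fglift_dom => -[|p m] /=; last by rewrite scale1r.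
by rewrite mem_dom x0 eqxx.
Qed.

(** With the first factor read as a polynomial in x and y: the partial derivatives, the integrals
    from 0 (which need characteristic zero), and the restrictions to x = 0 and y = 0. *)
Definition dx := hop (fun p => p.1%:R) (fun p => (p.1.-1, p.2)).
Definition dy := hop (fun p => p.2%:R) (fun p => (p.1, p.2.-1)).
Definition ix := hop (fun p => p.1.+1%:R^-1) (fun p => (p.1.+1, p.2)).
Definition iy := hop (fun p => p.2.+1%:R^-1) (fun p => (p.1, p.2.+1)).
Definition zx := hop (fun p => (p.1 == 0%N)%:R) id.
Definition zy := hop (fun p => (p.2 == 0%N)%:R) id.
HB.instance Definition _ := GRing.Linear.copy dx (hop (fun p => p.1%:R) (fun p => (p.1.-1, p.2))).
HB.instance Definition _ := GRing.Linear.copy dy (hop (fun p => p.2%:R) (fun p => (p.1, p.2.-1))).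
HB.instance Definition _ := GRing.Linear.copy ix (hop (fun p => p.1.+1%:R^-1) (fun p => (p.1.+1, p.2))).
HB.instance Definition _ := GRing.Linear.copy iy (hop (fun p => p.2.+1%:R^-1) (fun p => (p.1, p.2.+1))).
HB.instance Definition _ := GRing.Linear.copy zx (hop (fun p => (p.1 == 0%N)%:R) id).
HB.instance Definition _ := GRing.Linear.copy zy (hop (fun p => (p.2 == 0%N)%:R) id).

Lemma dx_ix x : coeff [::] x = 0 -> dx (ix x) = x.
Proof.
move=> x0; rewrite -[RHS](hop_id x0) /dx /ix hop_hop.
by apply: eq_hop => -[a b] //=; rewrite mulVf // natrS_neq0.
Qed.

Lemma dy_iy x : coeff [::] x = 0 -> dy (iy x) = x.
Proof.
move=> x0; rewrite -[RHS](hop_id x0) /dy /iy hop_hop.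
by apply: eq_hop => -[a b] //=; rewrite mulVf // natrS_neq0.
Qed.

Lemma ix_dx x : coeff [::] x = 0 -> ix (dx x) + zx x = x.
Proof.
move=> x0; rewrite -[RHS](hop_id x0) /dx /ix hop_hop.
rewrite (@eq_hop _ _ (fun p => (p.1 != 0%N)%:R) id) => [|[[|a] b]|[[|a] b]] //=.
- by rewrite hopD; apply: eq_hop => -[[|a] b] //=; rewrite ?add0r ?addr0.
- by rewrite mul0r.
- by rewrite mulfV // natrS_neq0.
- by rewrite mul0r eqxx.
Qed.

Lemma iy_dy x : coeff [::] x = 0 -> iy (dy x) + zy x = x.
Proof.
move=> x0; rewrite -[RHS](hop_id x0) /dy /iy hop_hop.
rewrite (@eq_hop _ _ (fun p => (p.2 != 0%N)%:R) id) => [|[a [|b]]|[a [|b]]] //=.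
- by rewrite hopD; apply: eq_hop => -[a [|b]] //=; rewrite ?add0r ?addr0.
- by rewrite mul0r.
- by rewrite mulfV // natrS_neq0.
- by rewrite mul0r eqxx.
Qed.

Lemma dx_dy x : dx (dy x) = dy (dx x).
Proof. by rewrite /dx /dy !hop_hop; apply: eq_hop => p //=; rewrite mulrC. Qed.

Lemma dy_ix x : dy (ix x) = ix (dy x).
Proof. by rewrite /ix /dy !hop_hop; apply: eq_hop => p //=; rewrite mulrC. Qed.

Lemma dy_zx x : dy (zx x) = zx (dy x).
Proof. by rewrite /zx /dy !hop_hop; apply: eq_hop => p //=; rewrite mulrC. Qed.

Lemma dx_iy_zx x : dx (iy (zx x)) = 0.
Proof.
rewrite /dx /iy /zx !hop_hop -(hop0 id x).
have f0 p : (p.1 == 0%N)%:R * (p.2.+1%:R^-1 * p.1%:R) = 0 :> K.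
  by case: p.1 => [|a] /=; rewrite ?mulr0 // !mul0r.
by apply: eq_hop => p /=; rewrite f0 ?eqxx.
Qed.

Definition epsm m : D := if m is p :: m' then (if p == one then bD m' else 0) else 0.
Definition eps : D -> D := fglift epsm.
HB.instance Definition _ := GRing.Linear.copy eps (fglift epsm).

Lemma eps1 p m : eps (bD (p :: m)) = if p == one then bD m else 0.
Proof. exact: fglift1. Qed.

Lemma eps_cns p x : eps (cns p x) = if p == one then x else 0.
Proof.
rewrite /cns linear_fglift; case: ifP => e.
  by rewrite -[RHS]fglift_id; apply: eq_fglift => m /=; rewrite eps1 e.
by rewrite -[RHS](fglift_0 D x); apply: eq_fglift => m /=; rewrite eps1 e.
Qed.

Lemma zy_zx x : zy (zx x) = cns one (eps x).
Proof.
rewrite /zy /zx hop_hop /eps linear_fglift; apply: eq_fglift => -[|[a b] m] /=.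
  by rewrite linear0.
by case: a => [|a]; case: b => [|b] /=; rewrite ?mulr0 ?mul0r ?mulr1 ?scale1r ?scale0r ?linear0 ?cns1.
Qed.

Lemma eps_Dl p m : eps (Dl p m) = bD (p :: m).
Proof.
rewrite /Dl linear_sum big_ord_recl /= [X in _ + X]big1 ?addr0 => [|i _]; last first.
  by rewrite linear_sum big1 // => j _; rewrite linearZ /= eps1 scaler0.
rewrite linear_sum big_ord_recl /= [X in _ + X]big1 ?addr0 => [|j _]; last first.
  by rewrite linearZ /= eps1 scaler0.
by rewrite linearZ /= eps1 /= !bin0 scale1r !subn0; case: p.
Qed.

(** The counit on the first factor is a contracting homotopy: (eps (x) 1) Delta = id returns x, and
    the other terms form the differential of [eps x]. *)
Lemma eps_dC x : eps (dC x) = x - dC (eps x).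
Proof.
have -> : x - dC (eps x) = fglift (fun m => bD m - dC (epsm m)) x.
  by rewrite fgliftB fglift_id; congr (_ - _); apply: (linear_fglift dC epsm x).
rewrite {1}/dC linear_fglift; apply: eq_fglift => m /=.
case: m => [|p m] /=.
  by rewrite /dCm /= subr0 linear0 subr0; apply: (eps1 one).
rewrite dCm_cons linearD linearB /= eps_Dl eps1 eps_cns.
by case: ifP => _; rewrite ?linear0 ?subr0 ?addr0 // dC1 /dCm opprB addrA addrAC.
Qed.

Lemma dC_contract x : dC x = 0 -> x = dC (eps x).
Proof. by move=> x0; apply/subr0_eq; rewrite -eps_dC x0 linear0. Qed.

(** The coproduct is p(x + x', y + y'), and derivatives commute with translations; this makes [dx]
    and [dy] chain maps for [dC]. *)
Lemma dx_Dl p m : dx (Dl p m) = p.1%:R *: Dl (p.1.-1, p.2) m.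
Proof.
case: p => [[|a] b]; rewrite /Dl linear_sum /=.
  rewrite big_ord1 linear_sum scale0r big1 // => j _.
  by rewrite linearZ /= /dx hop1 scale0r scaler0.
rewrite big_ord_recl [X in X + _]linear_sum /= [X in X + _]big1 ?add0r => [|j _]; last first.
  by rewrite linearZ /= /dx hop1 scale0r scaler0.
rewrite scaler_sumr; apply: eq_bigr => i _; rewrite linear_sum scaler_sumr; apply: eq_bigr => j _.
rewrite linearZ /= /dx hop1 /= !scalerA /bump /= add1n subSS -!natrM; congr (_%:R *: _).
by rewrite mulnAC mulnC [('C(_, _) * i.+1)%N]mulnC -mul_bin_diag; ring.
Qed.

Lemma dy_Dl p m : dy (Dl p m) = p.2%:R *: Dl (p.1, p.2.-1) m.
Proof.
rewrite /Dl linear_sum scaler_sumr /=; apply: eq_bigr => i _.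
case: p i => [a [|b]] i; rewrite linear_sum /=.
  by rewrite big_ord1 scale0r linearZ /= /dy hop1 scale0r scaler0.
rewrite big_ord_recl [X in X + _]linearZ /= /dy hop1 scale0r scaler0 add0r scaler_sumr.
apply: eq_bigr => j _.
rewrite linearZ /= hop1 /= !scalerA /bump /= add1n subSS -!natrM; congr (_%:R *: _).
by rewrite -mulnA [('C(_, _) * j.+1)%N]mulnC -mul_bin_diag; ring.
Qed.

Lemma hop_dC f h x : (forall p m, hop f h (Dl p m) = f p *: Dl (h p) m) -> f one = 0 ->
  hop f h (dC x) = dC (hop f h x).
Proof.
move=> hDl f1; rewrite {1}/dC {2}/hop !linear_fglift; apply: eq_fglift => -[|p m].
  by rewrite /= /dCm /= subr0 linear0 hop1 f1 scale0r.
by rewrite /= dCm_cons linearD linearB /= hDl hop1 hop_cns [dC _]linearZ /= dC1 dCm_cons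
  scalerDr scalerBr.
Qed.

Lemma dx_dC x : dx (dC x) = dC (dx x).
Proof. by apply: hop_dC => // p m; apply: dx_Dl. Qed.

Lemma dy_dC x : dy (dC x) = dC (dy x).
Proof. by apply: hop_dC => // p m; apply: dy_Dl. Qed.

End CobarCohomology.

(** * The first component is an isomorphism in cohomology *)

Section QuasiIsomorphism.
Variable K : fieldType.
Hypothesis charK0 : [pchar K] =i pred0.
Local Notation D := (DD K).
Local Notation bD := (bD K).
Local Notation bE := (bE K).
Local Notation one := (0, 0)%N.
Local Notation Fmor := (@Fmor K).
Implicit Types (v : seq (K * K)) (w : K * K) (m : Mon) (p q : nat * nat) (x y z : D).

Lemma coeff_fglift0 m (f : Mon -> D) x :
  (forall m', coeff m (f m') = 0) -> coeff m (fglift f x) = 0.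
Proof. by move=> f0; rewrite coeff_fglift big1 // => m' _; rewrite f0 mulr0. Qed.

Lemma coeff_bD m m' : coeff m (bD m') = (m' == m)%:R.
Proof. by rewrite coeffU mul1r. Qed.

Lemma coeff_nil_cns p y : coeff [::] (cns p y) = 0.
Proof. by apply: coeff_fglift0 => m; rewrite coeff_bD. Qed.

Lemma coeff_nil_dC x : coeff [::] (dC x) = 0.
Proof.
apply: coeff_fglift0 => -[|p m]; first by rewrite /dCm /= coeffB coeff0 coeff_bD subr0.
rewrite dCm_cons coeffD coeffB coeff_nil_cns coeff_bD subr0 addr0 raddf_sum big1 //= => i _.
by rewrite raddf_sum big1 //= => j _; rewrite coeffZ coeff_bD mulr0.
Qed.

Lemma coeff_eps m x : coeff m (eps x) = coeff (one :: m) x.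
Proof.
rewrite coeff_fglift coeff_expand; apply: eq_bigr => -[|p m'] _; congr (_ * _); first by rewrite coeff0.
by rewrite /= eqseq_cons; case: eqP => _; rewrite ?coeff_bD ?coeff0.
Qed.

Lemma coeff_dx_one m x : coeff (one :: m) (dx x) = coeff ((1, 0)%N :: m) x.
Proof.
rewrite coeff_fglift coeff_expand; apply: eq_bigr => -[|[a b] m'] _; congr (_ * _); first by rewrite coeff0.
rewrite /= coeffZ coeff_bD !eqseq_cons !xpair_eqE.
by case: a => [|[|a]] /=; rewrite ?mul0r ?mul1r ?mulr0.
Qed.

Lemma coeff_dy_one m x : coeff (one :: m) (dy x) = coeff ((0, 1)%N :: m) x.
Proof.
rewrite coeff_fglift coeff_expand; apply: eq_bigr => -[|[a b] m'] _; congr (_ * _); first by rewrite coeff0.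
rewrite /= coeffZ coeff_bD !eqseq_cons !xpair_eqE.
by case: b => [|[|b]] /=; rewrite ?andbF ?mul0r ?mul1r ?mulr0.
Qed.

(** For a cocycle z, [eps (dx z)] and [eps (dy z)] are [dC]-primitives of its derivatives; the curl
    measures how far this pair is from being a gradient, and it is again [dC]-closed. *)
Definition curl z : D := dy (eps (dx z)) - dx (eps (dy z)).

Lemma curlD z z' : curl (z + z') = curl z + curl z'.
Proof. by rewrite /curl !linearD /= addrACA. Qed.

Lemma curlZ c z : curl (c *: z) = c *: curl z.
Proof. by rewrite /curl scalerBr; congr (_ - _); rewrite !linearZ. Qed.

Section Cocycle.
Variable z : D.
Hypothesis dz : dK z = 0.

Let dCz : dC z = cns one z. Proof. by rewrite dCE dz subr0. Qed.

Lemma dx_cocycle : dx z = dC (eps (dx z)).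
Proof.
by apply: dC_contract; rewrite -dx_dC dCz /dx hop_cns scale0r.
Qed.

Lemma dy_cocycle : dy z = dC (eps (dy z)).
Proof.
by apply: dC_contract; rewrite -dy_dC dCz /dy hop_cns scale0r.
Qed.

Lemma dC_curl : dC (curl z) = 0.
Proof.
by rewrite /curl linearB /= -dy_dC -dx_cocycle -dx_dC -dy_cocycle dx_dy subrr.
Qed.

(* Dimension shifting along the Koszul resolution K -> C -> C^2 -> C: the partial
   derivatives of [z] are [dC]-exact, the primitives can be corrected to form a
   gradient [(dx g, dy g)], and [z - dC g] is then constant in the first factor. *)
Lemma cocycle_exact s :
    coeff [::] z = 0 -> coeff [:: (1, 0)%N] z = 0 -> coeff [:: (0, 1)%N] z = 0 ->
    coeff [::] s = 0 -> curl z = dC s ->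
  exists c, z = dK c.
Proof.
move=> z0 z10 z01 s0 zs.
(* Subtracting [dC (iy s)] keeps p a primitive of [dx z] and removes the curl, as dy (dC (iy s)) =
   dC s. *)
pose q := eps (dy z); pose p := eps (dx z) - dC (iy s).
have q0 : coeff [::] q = 0 by rewrite coeff_eps coeff_dy_one.
have p0 : coeff [::] p = 0.
  by rewrite /p coeffB coeff_nil_dC coeff_eps coeff_dx_one z10 subr0.
have dCp : dC p = dx z by rewrite /p linearB /= dC_dC // subr0 -dx_cocycle.
have dyp : dy p = dx q.
  rewrite /p linearB /= dy_dC (dy_iy charK0) // -zs /curl opprB addrCA.
  by rewrite subrr addr0.
(* The potential of the closed pair (p, q), integrated along the y-axis and then in the
   x-direction. *)
pose g := ix p + iy (zx q).
have dxg : dx g = p by rewrite linearD /= (dx_ix charK0) // dx_iy_zx addr0.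
have dyg : dy g = q.
  have zq0 : coeff [::] (zx q) = 0.
    by apply: coeff_fglift0 => -[|r m] /=; rewrite ?coeff0 // coeffZ coeff_bD mulr0.
  by rewrite linearD /= dy_ix dyp (dy_iy charK0) // (ix_dx charK0).
pose W := z - dC g.
have W0 : coeff [::] W = 0 by rewrite coeffB z0 coeff_nil_dC subr0.
have dxW : dx W = 0 by rewrite linearB /= dx_dC dxg dCp subrr.
have dyW : dy W = 0 by rewrite linearB /= dy_dC dyg /q -dy_cocycle subrr.
have zxW : zx W = W by rewrite -[RHS](ix_dx charK0 W0) dxW linear0 add0r.
have WE : W = cns one (eps W).
  by rewrite -zy_zx zxW -[LHS](iy_dy charK0 W0) dyW linear0 add0r.
exists (eps W).
have e : cns one z = cns one (dK (eps W)).
  by rewrite -dC_cns_one -WE /W linearB /= dC_dC // subr0 dCz.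
by rewrite -[LHS](eps_cns one) e eps_cns.
Qed.

End Cocycle.

Lemma EV_dKm_nil m : EV [::] (dKm K m) = 0.
Proof. by case: m => [|p m]; rewrite /= ?linear0 // linearB /= EV_dbar EV_cns_nil subr0. Qed.

Lemma EV_dKm1 w m : EV [:: w] (dKm K m) = 0.
Proof.
case: m => [|p m]; rewrite /= ?linear0 //.
by rewrite linearB /= EV_dbar EV_cns EV_dKm_nil mulr0 subr0.
Qed.

(** By cocommutativity coboundaries with two factors are symmetric, which separates them from e2 (x)
    e1. *)
Lemma EV_dKm2 w1 w2 m : EV [:: w1; w2] (dKm K m) = EV [:: w2; w1] (dKm K m).
Proof.
case: m => [|p m]; rewrite /= ?linear0 //.
rewrite [EV [:: w1; w2] _]linearB [EV [:: w2; w1] _]linearB /= !EV_dbar !EV_cns !EV_dKm1 !mulr0 !subr0 /mono /addp /=.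
by rewrite [w1.1 + _]addrC [w1.2 + _]addrC [w1.1 ^+ _ * _ + _]addrC.
Qed.

Lemma dD_dK y : exists y', dD y = dK y'.
Proof.
exists (fglift (fun m => sgn K (degM m) *: bD m) y).
rewrite linear_fglift; apply: eq_fglift => m /=.
by rewrite linearZ /= dK1 dD_monE.
Qed.

Lemma dK_dD c : exists y, dK c = dD y.
Proof.
exists (fglift (fun m => sgn K (degM m) *: bD m) c).
rewrite /dD linear_fglift; apply: eq_fglift => m /=.
by rewrite linearZ /= fglift1 dD_monE scalerA sgn_sqr scale1r.
Qed.

Lemma EV_dD_sym w1 w2 y :
  [/\ EV [::] (dD y) = 0, EV [:: w1] (dD y) = 0 &
      EV [:: w1; w2] (dD y) = EV [:: w2; w1] (dD y)].
Proof.
have [y' ->] := dD_dK y; rewrite /dK !EV_fglift; split.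
- rewrite (eq_fglift (g := fun=> 0 : K^o)) ?fglift_0 // => m; exact: EV_dKm_nil.
- rewrite (eq_fglift (g := fun=> 0 : K^o)) ?fglift_0 // => m; exact: EV_dKm1.
- by apply: eq_fglift => m; apply: EV_dKm2.
Qed.

Lemma jord1 : jord K 1 = 2%:R^-1 *: bD [:: (0, 1)%N; (1, 0)%N].
Proof.
apply: (EV_inj charK0) => v; rewrite EV_polyE linearZ /= EV1.
case: v => [|w1 [|w2 [|w3 v]]] /=; rewrite ?mulr0 ?scaler0 //.
by rewrite horner_ffpoly /ff big_ord1 subr0 /GRing.scale /= !expr0 !expr1; ring.
Qed.

Lemma Fmor1 : [/\ Fmor [:: Eone] = bD [::], Fmor [:: Ee1] = bD [:: (1, 0)%N],
  Fmor [:: Ee2] = bD [:: (0, 1)%N] & Fmor [:: Ew] = jord K 1].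
Proof.
by split=> //; rewrite (Fmor_cons K 0 (isT : Ee1 != Ew)) /= /logterm /logc /= mulr1 divr1 scale1r.
Qed.

Lemma Lin1E (x : EE K) : Lin1 Fmor x =
  coeff Eone x *: bD [::] + coeff Ee1 x *: bD [:: (1, 0)%N] +
  coeff Ee2 x *: bD [:: (0, 1)%N] + coeff Ew x *: jord K 1.
Proof.
have [Fu F1 F2 Fw] := Fmor1.
transitivity (\sum_(b : EB) coeff b x *: Fmor [:: b]).
  rewrite /Lin1 fgliftE [RHS](bigID (mem (dom x))) /= [X in _ = _ + X]big1 => [|b nb]; last first.
    by rewrite coeff_outdom ?scale0r.
  by rewrite addr0 -big_uniq ?uniq_dom.
rewrite !big_ord_recl big_ord0 addr0 !addrA -Fu -F1 -F2 -Fw.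
by do !congr (_ + _); congr (coeff _ _ *: Fmor [:: _]); apply: val_inj.
Qed.

Lemma Lin1_inj (x : EE K) y : Lin1 Fmor x = dD y -> x = 0.
Proof.
rewrite Lin1E jord1 scalerA => e.
have ev v : EV v (dD y) = coeff Eone x * evm v [::] + coeff Ee1 x * evm v [:: (1, 0)%N] +
    coeff Ee2 x * evm v [:: (0, 1)%N] + coeff Ew x / 2%:R * evm v [:: (0, 1)%N; (1, 0)%N].
  by rewrite -e !linearD /= !linearZ /= !EV1.
have [e0 _ _] := EV_dD_sym (0, 0) (0, 0) y.
(* These points are dual to e1 and e2, so evaluation reads off the coefficients; e2 (x) e1 is 1 at
   one order of the two points and 0 at the other. *)
have [_ e1 es] := EV_dD_sym (1, 0) (0, 1) y.
have [_ e2 _] := EV_dD_sym (0, 1) (0, 1) y.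
move: e0 e1 e2 es; rewrite !ev /= !expr0 !expr1 ?expr0n /= ?(mulr0, mul0r, mulr1, addr0, add0r).
move=> x0 x1 x2 /esym x3.
have {}x3 : coeff Ew x = 0.
  move/eqP: x3; rewrite mulf_eq0 invr_eq0 (pcharf0P K).1 // orbF; exact/eqP.
apply/eqP/freeg_eqP => b; rewrite coeff0.
by case: (EB_cases b) => ->.
Qed.

Lemma homogE0 k : homogE k (0 : EE K).
Proof. by move=> b; rewrite dom0. Qed.

Lemma homogE1 c b : homogE (degE b) (c *: bE b).
Proof. by move=> b' /domZ_subset; rewrite domU1 inE => /eqP ->. Qed.

Lemma homog_fglift k k' (f : Mon -> D) x :
  (forall m, degM m = k -> homogD k' (f m)) -> homogD k x -> homogD k' (fglift f x).
Proof.
move=> hf hx; rewrite fgliftE big_seq.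
by apply: homogD_sum => m mx; apply/homogDZ/hf/hx.
Qed.

Lemma homog_coeff k x m : homogD k x -> degM m != k -> coeff m x = 0.
Proof. by move=> hx /eqP nk; apply: coeff_outdom; apply/negP => /hx. Qed.

Lemma homog_hop k f h x : homogD k x -> homogD k (hop f h x).
Proof.
apply: homog_fglift => -[|p m] /= e; first exact: homogD0.
by apply: homogDZ; rewrite -e; exact: (@homogD1 K (h p :: m)).
Qed.

Lemma homog_eps k x : homogD (k + 1) x -> homogD k (eps x).
Proof.
apply: homog_fglift => -[|p m] /= e; first exact: homogD0.
case: ifP => _; last exact: homogD0.
have -> : k = degM m by move: e; rewrite /degM /=; lia.
exact: homogD1.
Qed.

Lemma homogN1E x : homogD (-1) x -> x = coeff [::] x *: bD [::].
Proof.
move=> hx; apply/eqP/freeg_eqP => m; rewrite coeffZ coeff_bD.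
case: m => [|p m]; first by rewrite mulr1.
by rewrite mulr0; apply: (homog_coeff hx); rewrite /degM /=; lia.
Qed.

Lemma dK_homog k z : homogD k z -> dD z = 0 -> dK z = 0.
Proof.
move=> hz dz; have e : dD z = sgn K k *: dK z.
  rewrite /dD /dK -fgliftZ; apply: eq_fglift_dom => m /hz <-; exact: dD_monE.
by rewrite -[dK z]scale1r -(sgn_sqr K k) -scalerA -e dz scaler0.
Qed.

Lemma dK_jord1 : dK (jord K 1) = 0.
Proof.
apply: (@dK_homog 1); first exact: homogD_polyE.
apply: (EV_eq0 charK0) => v; rewrite EV_dD_polyE.
case: v => [|w1 [|w2 [|w3 [|w4 v]]]] //.
by rewrite !horner_ffpoly /ff !big_ord1 !subr0 !expr1; ring.
Qed.

Lemma curl_jord1 : curl (jord K 1) = - 2%:R^-1 *: bD [:: one].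
Proof.
have dx0 : dx (bD [:: (0, 1)%N; (1, 0)%N]) = 0 by rewrite /dx hop1 scale0r.
have dy0 : dy (bD [:: (0, 1)%N; (1, 0)%N]) = bD [:: one; (1, 0)%N] by rewrite /dy hop1 scale1r.
have dx1 : dx (bD [:: (1, 0)%N]) = bD [:: one] by rewrite /dx hop1 scale1r.
by rewrite jord1 curlZ /curl dx0 dy0 eps1 /= dx1 linear0 linear0 sub0r scaleNr scalerN.
Qed.

Lemma Lin1_surj k z : homogD k z -> dD z = 0 ->
  exists x : EE K, homogE k x /\ exists y : D, z = Lin1 Fmor x + dD y.
Proof.
move=> hz /(dK_homog hz) dz.
have hc m : degM m != k -> coeff m z = 0 by apply: homog_coeff.
have exact_case : (exists c, z = dK c) -> exists x : EE K, homogE k x /\ exists y : D, z = Lin1 Fmor x + dD y.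
  case=> c ->; exists 0; split; first exact: homogE0.
  by have [y ->] := dK_dD c; exists y; rewrite /Lin1 linear0 add0r.
have [Fu F1 F2 Fw] := Fmor1.
have Lin1Z c b : Lin1 Fmor (c *: bE b) = c *: Fmor [:: b].
  by rewrite /Lin1 linearZ /= fglift1.
have Lin1D (x1 x2 : EE K) : Lin1 Fmor (x1 + x2) = Lin1 Fmor x1 + Lin1 Fmor x2.
  exact: linearD.
case: k hz hc exact_case => [[|[|k]]|[|k]] hz hc exact_case.
(* Degree 0: both derivatives of z are constants, so z = a e1 + b e2 + c; and c = 0 because the
   differential of 1 is 1 (x) 1. *)
- pose a := coeff [::] (eps (dx z)); pose b := coeff [::] (eps (dy z)).
  have dCu : dC (bD [::]) = bD [:: one] by rewrite dC1 /dCm subr0.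
  have dxz : dx z = a *: bD [:: one].
    rewrite {1}(dx_cocycle dz) (@homogN1E _ (@homog_eps (-1) _ (@homog_hop 0 _ _ _ hz))).
    by rewrite linearZ /= dCu.
  have dyz : dy z = b *: bD [:: one].
    rewrite {1}(dy_cocycle dz) (@homogN1E _ (@homog_eps (-1) _ (@homog_hop 0 _ _ _ hz))).
    by rewrite linearZ /= dCu.
  have z0 : coeff [::] z = 0 by apply: hc.
  have zz0 : coeff [::] (zx z) = 0.
    by apply: coeff_fglift0 => -[|r m] /=; rewrite ?coeff0 // coeffZ coeff_bD mulr0.
  have [c zE] : exists c, z = a *: bD [:: (1, 0)%N] + (b *: bD [:: (0, 1)%N] + c *: bD [:: one]).
    exists (coeff [::] (eps z)).
    rewrite -[LHS](ix_dx charK0 z0) -[zx z](iy_dy charK0 zz0) zy_zx dy_zx dxz dyz.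
    rewrite {1}(@homogN1E _ (@homog_eps (-1) _ hz)) !linearZ /= cns1.
    by rewrite /ix /iy /zx !hop1 /= !invr1 !scale1r hop1 /= invr1 scale1r.
  have dKp p : p = (1, 0)%N \/ p = (0, 1)%N -> dK (bD [:: p]) = 0.
    move=> pE; apply: (EV_eq0 charK0) => v; rewrite dK1 /= linear0 subr0 EV_dbar.
    by case: v => [|w1 [|w2 v]] //; case: pE => ->; rewrite /mono /= !expr0 !expr1; ring.
  have c0 : c = 0.
    move: dz; rewrite zE !linearD /= !linearZ /= (dKp _ (or_introl erefl)) (dKp _ (or_intror erefl)).
    rewrite !scaler0 !add0r dK1 /= linear0 subr0 /dbar Dl_one addrK => /(congr1 (coeff [:: one; one])).
    by rewrite coeffZ coeff_bD eqxx mulr1 coeff0.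
  exists (a *: bE Ee1 + b *: bE Ee2); split.
    by move=> b' /domD_subset; rewrite mem_cat => /orP[] /homogE1.
  by exists 0; rewrite /dD linear0 addr0 Lin1D !Lin1Z F1 F2 [LHS]zE c0 scale0r addr0.
(* Degree 1: the curl is a scalar multiple of 1, the only obstruction to exactness. As [jord 1] has
   curl -1/2, adding 2l times it removes the obstruction. *)
- pose l := coeff [::] (eps (curl z)).
  have hcurl : homogD 0 (curl z).
    by apply: homogDB; apply/homog_hop/(homog_eps (k := 0))/homog_hop.
  have curlE : curl z = l *: bD [:: one].
    rewrite (dC_contract (dC_curl dz)) (@homogN1E _ (@homog_eps (-1) _ hcurl)).
    by rewrite linearZ /= dC1 /dCm subr0.
  have nz2 : 2%:R != 0 :> K by rewrite (pcharf0P K).1.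
  pose z' := z + (2%:R * l) *: jord K 1.
  have hz' : homogD 1 z' by apply: homogDD => //; apply/homogDZ/homogD_polyE.
  have dz' : dK z' = 0 by rewrite linearD linearZ /= dz dK_jord1 scaler0 addr0.
  have cz' : curl z' = dC 0.
    rewrite curlD curlZ curlE curl_jord1 linear0 scalerA -scalerDl mulrN mulrAC mulfV // mul1r.
    by rewrite subrr scale0r.
  have [c zE] : exists c, z' = dK c.
    by apply: (cocycle_exact dz' _ _ _ _ cz'); rewrite ?(homog_coeff hz') ?coeff0.
  exists (- (2%:R * l) *: bE Ew); split; first exact: (@homogE1 _ Ew).
  have [y yE] := dK_dD c; exists y.
  by rewrite -yE -zE Lin1Z Fw /z' addrCA scaleNr addNr addr0.
(* Degree at least 2: [eps (curl z)] has degree at least 0, hence no component on the empty list,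
   and every cocycle is exact. *)
- apply: exact_case; apply: (cocycle_exact dz (s := eps (curl z))); rewrite ?hc //.
    by rewrite coeff_eps coeffB coeff_dy_one coeff_dx_one !coeff_eps coeff_dx_one coeff_dy_one !hc // subrr.
  exact/dC_contract/dC_curl.
- exists (coeff [::] z *: bE Eone); split; first exact: (@homogE1 _ Eone).
  by exists 0; rewrite /dD linear0 addr0 Lin1Z Fu; apply: homogN1E.
- have -> : z = 0.
    apply/eqP/freeg_eqP => m; rewrite coeff0; apply: hc; rewrite /degM NegzE.
    by apply/eqP; lia.
  exists 0; split; first exact: homogE0.
  by exists 0; rewrite /Lin1 /dD !linear0 addr0.
Qed.

Lemma quasi_iso_Fmor : quasi_iso Fmor.
Proof.
split=> [k x _ [y]|]; first exact: Lin1_inj.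
exact: Lin1_surj.
Qed.

End QuasiIsomorphism.

(* K a field of characteristic zero; the Drinfeld DGLA (x) U_b of the
   Borel subalgebra b of sl_2(K) is formal: there is an L_infinity
   quasi-isomorphism E(b) ~> (x) U_b. *)
Theorem mainTheorem7 (K : fieldType) (charK0 : [pchar K] =i pred0) :
  exists F : seq (EB) -> DD K, Linf_morphism F /\ quasi_iso F.
Proof.
by exists (@Fmor K); split; [exact: Linf_Fmor | exact: quasi_iso_Fmor].
Qed.
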